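(* Let $\mu:\mathbb{R}\to\mathbb{R}$ and $\sigma:\mathbb{R}\to(0,+\infty)$ be continuous functions, suppose that $\sigma$ is locally $\omega$-continuous for some modulus of continuity $\omega$, and that there exist constants $\alpha,M_1,M_2>0$ such that $\sigma(x)+|\mu(x)|\le M_1+M_2|x|^{\alpha}$ for all $x\in\mathbb{R}$. Let $I_Z$ be the good rate function of the large deviation principle with speed $\varepsilon_n^{-2}$ on $C_0[0,T]$ satisfied by the family $(Z^n-x_0)_{n\in\mathbb{N}}$, i.e. $I_Z(x)=\lim_{\delta\to0}\liminf_{m\to+\infty}\inf_{\|y-x\|_\infty<\delta}I_Z^m(y)=\lim_{\delta\to0}\limsup_{m\to+\infty}\inf_{\|y-x\|_\infty<\delta}I_Z^m(y)$. Then $I_Z(x)=\mathcal{I}_Z(x)$ for every $x\in C_0[0,T]$, where $$\mathcal{I}_{Z}(x)=\begin{cases}\displaystyle\inf_{f\in H_0^1[0,T]}\left\{\frac12\|f\|^2_{H_0^1[0,T]}+\frac12\int_0^T\left(\frac{\dot{x}(t)-\mu(\hat{f}(t))-\rho\,\sigma(\hat f(t))\dot f(t)}{\bar{\rho}\,\sigma(\hat{f}(t))}\right)^2dt\right\}& x\in H_0^1[0,T],\\ +\infty& x\in C_0[0,T]\setminus H_0^1[0,T].\end{cases}$$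
   Context: Fix $T>0$. $C_0[0,T]$ is the space of continuous real functions on $[0,T]$ vanishing at $0$, with the sup-norm. $H_0^1[0,T]$ is the set of absolutely continuous $f$ with $f(0)=0$ and $\dot f\in L^2[0,T]$, with $\|f\|_{H_0^1[0,T]}^2=\int_0^T\dot f(s)^2ds$. $W$ and $B$ are independent standard Brownian motions. $K$ is a measurable square integrable kernel on $[0,T]^2$ with $\sup_{t\in[0,T]}\int_0^TK(t,s)^2ds<\infty$ such that: (a) $K(0,s)=0$ for all $s\in[0,T]$ and $K(t,s)=0$ for all $0\le t<s\le T$; (b) there are constants $c,a>0$ with $\sup_{|t_1-t_2|\le\delta}\int_0^T|K(t_1,s)-K(t_2,s)|^2ds\le c\,\delta^{a}$ for all $\delta\in[0,T]$. $\hat B_t=\int_0^tK(t,s)\,dB_s$ (continuous version) is the associated Volterra type Gaussian process, assumed non-degenerate. For $f\in H_0^1[0,T]$, $\hat f(t)=\int_0^tK(t,s)\dot f(s)\,ds$. $\rho\in(-1,1)$, $\bar\rho=\sqrt{1-\rho^2}$, $x_0\in\mathbb{R}$, and $(\varepsilon_n)$ is a sequence of positive numbers with $\varepsilon_n\to0$. The processes are $$Z_t^{n}=x_0+\int_0^t\Big(\mu(\varepsilon_n\hat{B}_s)-\tfrac12\varepsilon_n^{2}\sigma(\varepsilon_n\hat{B}_s)^2\Big)ds+\varepsilon_n\bar{\rho}\int_0^t\sigma(\varepsilon_n\hat{B}_s)\,dW_s+\varepsilon_n\rho\int_0^t\sigma(\varepsilon_n\hat{B}_s)\,dB_s,\quad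 t\in[0,T].$$ For $m\ge1$, $I_Z^m(x)=+\infty$ if $x\in C_0[0,T]\setminus H_0^1[0,T]$ and, for $x\in H_0^1[0,T]$, $$I_{Z}^m(x)=\inf_{f\in H_0^1[0,T]}\left\{\frac12\|f\|^2_{H_0^1[0,T]}+\frac12\int_0^T\left(\frac{\dot{x}(t)-\mu(\hat{f}(t))-\rho\,\sigma\big(\hat f(\lfloor\frac{mt}{T}\rfloor\frac Tm)\big)\dot f(t)}{\bar{\rho}\,\sigma(\hat{f}(t))}\right)^2dt\right\}.$$ Under the continuity and local $\omega$-continuity hypotheses, $(Z^n-x_0)_n$ satisfies an LDP on $C_0[0,T]$ with speed $\varepsilon_n^{-2}$ and good rate function $I_Z$ given by the two (equal) limit expressions $I_Z(x)=\lim_{\delta\to0}\liminf_{m\to+\infty}\inf_{\|y-x\|_\infty<\delta}I_Z^m(y)=\lim_{\delta\to0}\limsup_{m\to+\infty}\inf_{\|y-x\|_\infty<\delta}I_Z^m(y)$, where $y$ ranges over $C_0[0,T]$. A modulus of continuity is an increasing function $\omega:[0,+\infty)\to[0,+\infty)$ with $\omega(0)=0$ and $\lim_{x\to0}\omega(x)=0$. A function $g:\mathbb{R}\to\mathbb{R}$ is locally $\omega$-continuous if for every $\delta>0$ there is $L(\delta)>0$ with $|g(x)-g(y)|\le L(\delta)\,\omega(|x-y|)$ for all $x,y\in[-\delta,\delta]$. LDP: laws $\mu_n$ on $E=C_0[0,T]$ satisfy an LDP with speed $\gamma_n\to+\infty$ and rate function $I$ (lower semicontinuous $I:E\to[0,+\infty]$)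 if $\liminf_n\gamma_n^{-1}\log\mu_n(\Theta)\ge-\inf_{\Theta}I$ for every open $\Theta$ and $\limsup_n\gamma_n^{-1}\log\mu_n(\Gamma)\le-\inf_{\Gamma}I$ for every closed $\Gamma$; $I$ is good if its sublevel sets $\{I\le a\}$ are compact. *)

(* Defs.v *)
From HB Require Import structures.
From mathcomp Require Import all_boot all_order all_algebra.
From mathcomp Require Import all_classical all_reals all_analysis.
Set Implicit Arguments.
Unset Strict Implicit.
Unset Printing Implicit Defensive.
Import Order.TTheory GRing.Theory Num.Theory.
Import numFieldNormedType.Exports.
Local Open Scope classical_set_scope.
Local Open Scope ring_scope.

Section function_spaces.
Variables (R : realType) (T : R).
Implicit Types f x y : R -> R.
Local Notation leb := (@lebesgue_measure R).

(* Used as a type through the coercion of sets to subtypes, [C0 T] carries the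
   topology of uniform convergence on [0, T].  Values outside [0, T] are pinned
   to 0, so that an element is determined by its restriction to [0, T]. *)
Definition C0 : set {uniform` `[0, T] -> R} :=
  [set x | [/\ {within `[0, T], continuous (x : R -> R)},
               (x : R -> R) 0 = 0 &
               forall t : R, t \notin `[0, T] -> (x : R -> R) t = 0]].

Definition C0_fun (x : C0) : R -> R := set_val x.

Definition sup_norm f : R := sup [set `|f t| | t in `[0, T]].

Definition square_integrable (g : R -> R) :=
  measurable_fun `[0, T] g /\
  (\int[leb]_(t in `[0%R, T]) ((g t) ^+ 2)%:E < +oo)%E.

Definition absolutely_continuous f :=
  forall e : R, 0 < e -> exists2 d : R, 0 < d &
    forall (n : nat) (l r : 'I_n -> R),
      (forall i, [/\ 0 <= l i, l i <= r i & r i <= T]) ->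
      trivIset setT (fun i => `]l i, r i[%classic) ->
      \sum_(i < n) (r i - l i) < d ->
      \sum_(i < n) `|f (r i) - f (l i)| < e.

(* The dot derivative of an absolutely continuous function is the total
   function [derive1 f], the usual derivative wherever it exists.  Existence almost
   everywhere is automatic for absolutely continuous functions; it is recorded
   because [derive1 f] takes a junk value elsewhere. *)
Definition H01 : set (R -> R) :=
  [set f | [/\ absolutely_continuous f, f 0 = 0,
               {ae leb, forall t : R, t \in `]0, T[ -> derivable f t 1} &
               square_integrable (derive1 f)]].

Definition H01_norm2 f : \bar R := \int[leb]_(t in `[0, T]) ((derive1 f t) ^+ 2)%:E.

End function_spaces.

Arguments C0 {R} T _.
Arguments C0_fun {R T} x _.

Section coefficients.
Variable R : realType.

(* "Increasing" is read as nondecreasing. *)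
Definition modulus_of_continuity (omega : R -> R) :=
  [/\ forall x : R, 0 <= x -> 0 <= omega x,
      forall x y : R, 0 <= x -> x <= y -> omega x <= omega y,
      omega 0 = 0 &
      omega x @[x --> 0^'+] --> 0].

Definition locally_continuous (omega g : R -> R) :=
  forall delta : R, 0 < delta -> exists2 L, 0 < L &
    forall x y : R, x \in `[- delta, delta] -> y \in `[- delta, delta] ->
      `|g x - g y| <= L * omega `|x - y|.

End coefficients.

Section kernel.
Variables (R : realType) (T : R) (K : R -> R -> R).
Local Notation leb := (@lebesgue_measure R).

Definition volterra_kernel :=
  [/\ measurable_fun (`[0, T] `*` `[0, T]) (fun p : R * R => K p.1 p.2),
      (\int[(leb \x leb)%E]_(p in `[0%R, T] `*` `[0%R, T])
         ((K p.1 p.2) ^+ 2)%:E < +oo)%E &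
      (ereal_sup [set \int[leb]_(s in `[0%R, T]) ((K t s) ^+ 2)%:E
                 | t in `[0%R, T]] < +oo)%E].

Definition kernel_causal :=
  (forall s : R, s \in `[0, T] -> K 0 s = 0) /\
  (forall t s : R, 0 <= t -> t < s -> s <= T -> K t s = 0).

Definition kernel_dist2 (t1 t2 : R) : \bar R :=
  \int[leb]_(s in `[0, T]) (`|K t1 s - K t2 s| ^+ 2)%:E.

Definition close_times (delta : R) : set (R * R) :=
  [set p : R * R | [/\ p.1 \in `[0, T], p.2 \in `[0, T] & `|p.1 - p.2| <= delta]].

Definition kernel_holder :=
  exists c a : R, [/\ 0 < c, 0 < a &
    forall delta : R, delta \in `[0, T] ->
      (ereal_sup [set kernel_dist2 p.1 p.2 | p in close_times delta]
       <= (c * delta `^ a)%:E)%E].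

Definition hat (f : R -> R) (t : R) : R :=
  \int[leb]_(s in `[0, t]) (K t s * derive1 f s).

End kernel.

Section rate_functions.
Variables (R : realType) (T : R) (K : R -> R -> R) (mu sigma : R -> R) (rho : R).
Local Notation leb := (@lebesgue_measure R).

Definition rho_bar : R := Num.sqrt (1 - rho ^+ 2).

(* [tau] is the time change inside the correlation term: the identity for the
   limiting functional, projection on a grid for the discretized ones. *)
Definition cost (tau : R -> R) (x f : R -> R) : \bar R :=
  ((2^-1)%:E * H01_norm2 T f +
   (2^-1)%:E * \int[leb]_(t in `[0%R, T])
     (((derive1 x t - mu (hat K f t) - rho * sigma (hat K f (tau t)) * derive1 f t)
       / (rho_bar * sigma (hat K f t))) ^+ 2)%:E)%E.

Definition rate (tau : R -> R) (x : C0 T) : \bar R :=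
  if C0_fun x \in H01 T then ereal_inf [set cost tau (C0_fun x) f | f in H01 T]
  else +oo%E.

Definition grid (m : nat) (t : R) : R :=
  (Num.floor (m%:R * t / T))%:~R * (T / m%:R).

(* Meaningful for m >= 1 only; the value at m = 0 does not affect limits in m. *)
Definition rate_m (m : nat) : C0 T -> \bar R := rate (grid m).

Definition rate_Z : C0 T -> \bar R := rate id.

Definition local_inf (m : nat) (x : C0 T) (delta : R) : \bar R :=
  ereal_inf [set rate_m m y
            | y in [set y | sup_norm T (C0_fun y \- C0_fun x) < delta]].

End rate_functions.

Section large_deviations.
Variables (R : realType) (E : topologicalType).
Local Open Scope ereal_scope.

Definition rate_function (I : E -> \bar R) :=
  (forall x, 0 <= I x) /\ lower_semicontinuous I.

Definition good_rate_function (I : E -> \bar R) :=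
  rate_function I /\ forall a : R, (0 <= a)%R -> compact [set x | I x <= a%:E].

Definition LDP (law : nat -> set E -> \bar R) (gamma : nat -> R)
    (I : E -> \bar R) :=
  [/\ gamma n @[n --> \oo] --> +oo%R,
      rate_function I,
      forall Theta : set E, open Theta ->
        - ereal_inf [set I x | x in Theta]
          <= limn_einf (fun n => ((gamma n)^-1)%:E * lne (law n Theta)) &
      forall Gamma : set E, closed Gamma ->
        limn_esup (fun n => ((gamma n)^-1)%:E * lne (law n Gamma))
          <= - ereal_inf [set I x | x in Gamma]].

End large_deviations.

Section processes.
Context {d : measure_display} {Omega : measurableType d} {R : realType}.
Variable P : probability Omega R.
Local Notation leb := (@lebesgue_measure R).

Definition sigma_gen (J : set (Omega -> R)) : set (set Omega) :=
  <<s \bigcup_(X in J) preimage_set_system setT X measurable >>.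

Definition independent_systems (F G : set (set Omega)) :=
  forall A B, F A -> G B -> P (A `&` B) = (P A * P B)%E.

Definition brownian_motion (B : R -> {RV P >-> R}) :=
  [/\ forall w, B 0 w = 0,
      forall w, {within `[0, +oo[, continuous (fun t : R => B t w)},
      forall s t : R, 0 <= s -> s < t ->
        forall A : set R, measurable A ->
          P ((fun w => B t w - B s w) @^-1` A)
          = normal_prob 0 (Num.sqrt (t - s)) A &
      forall s t : R, 0 <= s -> s < t ->
        independent_systems
          (sigma_gen [set (B u : Omega -> R) | u in `[0, s]])
          (sigma_gen [set (fun w => B t w - B s w)])].

Definition independent_processes (W B : R -> {RV P >-> R}) :=
  independent_systems
    (sigma_gen [set (W u : Omega -> R) | u in `[0, +oo[])
    (sigma_gen [set (B u : Omega -> R) | u in `[0, +oo[]).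

Definition joint_filtration (W B : R -> {RV P >-> R}) (t : R) : set (set Omega) :=
  sigma_gen ([set (W u : Omega -> R) | u in `[0, t]] `|`
             [set (B u : Omega -> R) | u in `[0, t]]).

Record simple_process := SimpleProcess {
  nsteps : nat;
  height : 'I_nsteps -> Omega -> R;
  lpt : 'I_nsteps -> R;
  rpt : 'I_nsteps -> R }.

Definition adapted_simple (F : R -> set (set Omega)) (h : simple_process) :=
  forall i : 'I_(nsteps h),
    [/\ 0 <= lpt i, lpt i <= rpt i,
        exists c : R, forall w, `|height i w| <= c &
        forall A : set R, measurable A -> F (lpt i) (height i @^-1` A)].

Definition simple_value (h : simple_process) (s : R) (w : Omega) : R :=
  \sum_(i < nsteps h) height i w * \1_(`]lpt i, rpt i]%classic) s.

Definition simple_integral (M : R -> {RV P >-> R}) (h : simple_process)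
    (t : R) (w : Omega) : R :=
  \sum_(i < nsteps h)
    height i w * (M (Num.min (rpt i) t) w - M (Num.min (lpt i) t) w).

Definition cvg0_in_probability (Y : nat -> Omega -> \bar R) :=
  forall e : R, 0 < e ->
    P [set w | (e%:E < Y k w)%E] @[k --> \oo] --> (0 : \bar R)%E.

(* [X] is a version of the Ito integral of [H] against the [F]-Brownian motion
   [M] over [0, t]: approximation of the integrand by bounded adapted simple
   processes, in probability.  For deterministic [H] it is the Wiener integral. *)
Definition ito_integral (F : R -> set (set Omega)) (M : R -> {RV P >-> R})
    (H : R -> Omega -> R) (t : R) (X : Omega -> R) :=
  exists h : nat -> simple_process,
    [/\ forall k, adapted_simple F (h k),
        cvg0_in_probability (fun k w =>
          \int[leb]_(s in `[0%R, t])
            ((simple_value (h k) s w - H s w) ^+ 2)%:E)%E &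
        cvg0_in_probability (fun k w =>
          (`|simple_integral M (h k) t w - X w|)%:E)].

Definition volterra_process (T : R) (K : R -> R -> R)
    (F : R -> set (set Omega)) (B Bhat : R -> {RV P >-> R}) :=
  (forall w, {within `[0, T], continuous (fun t : R => Bhat t w)}) /\
  (forall t : R, t \in `[0, T] -> ito_integral F B (fun s _ => K t s) t (Bhat t)).

(* Non-degeneracy in the weak sense: only one-dimensional marginals are
   required to be non-degenerate Gaussian laws. *)
Definition nondegenerate_process (T : R) (Bhat : R -> {RV P >-> R}) :=
  forall t : R, t \in `]0, T] -> (0 < 'V_P[Bhat t])%E.

Definition log_price (T : R) (mu sigma : R -> R) (rho x0 eps : R)
    (F : R -> set (set Omega)) (W B Bhat Z : R -> {RV P >-> R}) :=
  exists IW IB : R -> {RV P >-> R},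
    forall t : R, t \in `[0, T] ->
      [/\ ito_integral F W (fun s w => sigma (eps * Bhat s w)) t (IW t),
          ito_integral F B (fun s w => sigma (eps * Bhat s w)) t (IB t) &
          {ae P, forall w,
            Z t w = x0
              + \int[leb]_(s in `[0, t])
                  (mu (eps * Bhat s w)
                   - 2^-1 * eps ^+ 2 * (sigma (eps * Bhat s w)) ^+ 2)
              + eps * rho_bar rho * IW t w
              + eps * rho * IB t w}].

End processes.

(* Main.v *)
Require Import Defs.
From HB Require Import structures.
From mathcomp Require Import all_boot all_order all_algebra ring lra.
From mathcomp Require Import all_classical all_reals all_analysis.
From mathcomp Require Import measurable_realfun.
Set Implicit Arguments.
Unset Strict Implicit.
Unset Printing Implicit Defensive.
Import Order.TTheory GRing.Theory Num.Theory.
Import numFieldNormedType.Exports.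
Local Open Scope classical_set_scope.
Local Open Scope ring_scope.

(* I_Z <= rate_Z: for fixed x and f the trajectory hat f is uniformly continuous,
   so the cost discretized on a grid converges to the cost as the grid is refined.

   rate_Z <= I_Z: if I_Z x < c, there are y_k -> x uniformly, grids m_k -> oo and
   f_k with cost less than c.  The f_k' and the integrands u_k of the second cost
   term are bounded in L^2, and the hat f_k are equibounded and equicontinuous
   because the kernel is continuous in L^2, so along an ultrafilter they converge
   uniformly to some phi.  Substituting phi for hat f_k, with or without the grid,
   y_k' = mu(phi) + rho sigma(phi) f_k' + rho_bar sigma(phi) u_k up to a small
   error.  For fixed phi, the pairs (g, u) with |g|^2 + |u|^2 <= 2c for which the
   Volterra integral of g is e-close to phi and the integral of
   mu(phi) + rho sigma(phi) g + rho_bar sigma(phi) u is e-close to x form a convex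
   set, nonempty for every e > 0.  Elements of nearly minimal norm converge
   strongly in L^2 as e -> 0, by the parallelogram law; this replaces weak
   compactness.  The limit (g, u) satisfies the constraints exactly, so the
   primitive f of g has hat f = phi, x is in H01 and the cost of f is at most c.
   Absolutely continuous functions are recovered from their derivatives by a
   Cousin covering argument. *)

(** * Square integrable functions *)

Section square_integrable_functions.
Context {d : measure_display} {S : measurableType d} {R : realType}.
Variables (m : {measure set S -> \bar R}) (D : set S).
Hypothesis mD : measurable D.
Implicit Types f g : S -> R.

Definition L2 g :=
  measurable_fun D g /\ m.-integrable D (EFin \o (fun x => g x ^+ 2)).

Definition N2 g : R := \int[m]_(x in D) (g x ^+ 2).

Lemma N2_ge0 g : 0 <= N2 g.
Proof. by apply: Rintegral_ge0 => x _; rewrite sqr_ge0. Qed.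

Lemma le_integrableR f g : measurable_fun D f ->
  (forall x, D x -> `|f x| <= g x) ->
  m.-integrable D (EFin \o g) -> m.-integrable D (EFin \o f).
Proof.
move=> mf fg; apply: le_integrable => //; first exact/measurable_EFinP.
by move=> x Dx; rewrite /= lee_fin (le_trans (fg _ Dx))// ler_norm.
Qed.

Lemma integrableRD f g : m.-integrable D (EFin \o f) ->
  m.-integrable D (EFin \o g) -> m.-integrable D (EFin \o (fun x => f x + g x)).
Proof. by move=> fi gi; exact: (integrableD mD fi gi). Qed.

Lemma integrableRB f g : m.-integrable D (EFin \o f) ->
  m.-integrable D (EFin \o g) -> m.-integrable D (EFin \o (fun x => f x - g x)).
Proof. by move=> fi gi; exact: (integrableB mD fi gi). Qed.

Lemma integrableRZ a f : m.-integrable D (EFin \o f) ->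
  m.-integrable D (EFin \o (fun x => a * f x)).
Proof. by move=> fi; exact: (integrableZl mD a fi). Qed.

Lemma L2_mul_integrable f g : L2 f -> L2 g ->
  m.-integrable D (EFin \o (fun x => f x * g x)).
Proof.
move=> [mf f2] [mg g2].
apply: (@le_integrableR _ (fun x => f x ^+ 2 + g x ^+ 2)).
- exact: measurable_funM.
- by move=> x _; rewrite ler_norml; nra.
- exact: integrableRD.
Qed.

Lemma L2_linear a b f g : L2 f -> L2 g -> L2 (fun x => a * f x + b * g x).
Proof.
move=> Lf Lg; have [mf f2] := Lf; have [mg g2] := Lg.
have mh : measurable_fun D (fun x => a * f x + b * g x).
  by apply: measurable_funD; apply: measurable_funM.
split=> //.
apply: (@le_integrableR _ (fun x => (2 * a ^+ 2) * f x ^+ 2 + (2 * b ^+ 2) * g x ^+ 2)).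
- exact: measurable_funX.
- move=> x _; rewrite ger0_norm ?sqr_ge0//.
  by have := sqr_ge0 (a * f x - b * g x); nra.
- by apply: integrableRD; exact: integrableRZ.
Qed.

Lemma L2_ext f g : {in D, f =1 g} -> L2 f -> L2 g.
Proof.
move=> fg [mf f2]; split.
  by apply: eq_measurable_fun mf => x Dx; exact: fg.
by apply: eq_integrable f2 => // x Dx; rewrite /= fg.
Qed.

Lemma L2D f g : L2 f -> L2 g -> L2 (fun x => f x + g x).
Proof.
by move=> ? ?; apply: (@L2_ext (fun x => 1 * f x + 1 * g x)) => [x _|];
  [rewrite !mul1r|exact: L2_linear].
Qed.

Lemma L2B f g : L2 f -> L2 g -> L2 (fun x => f x - g x).
Proof.
by move=> ? ?; apply: (@L2_ext (fun x => 1 * f x + (-1) * g x)) => [x _|];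
  [rewrite mul1r mulN1r|exact: L2_linear].
Qed.

Lemma L2_bounded_mul (b : S -> R) f (C : R) : measurable_fun D b ->
  (forall x, D x -> `|b x| <= C) -> L2 f -> L2 (fun x => b x * f x).
Proof.
move=> mb bC [mf f2]; split; first exact: measurable_funM.
apply: (@le_integrableR _ (fun x => C ^+ 2 * f x ^+ 2)).
- by apply: measurable_funX; exact: measurable_funM.
- move=> x Dx; rewrite ger0_norm ?sqr_ge0// exprMn ler_wpM2r ?sqr_ge0//.
  by rewrite -(real_normK (num_real (b x))) lerXn2r ?nnegrE// ?(le_trans _ (bC _ Dx)).
- exact: integrableRZ.
Qed.

Lemma L2_bounded (b : S -> R) (C : R) : (m D < +oo)%E -> measurable_fun D b ->
  (forall x, D x -> `|b x| <= C) -> L2 b.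
Proof.
move=> Doo mb bC; split=> //.
apply: (@le_integrableR _ (fun x => C ^+ 2)).
- exact: measurable_funX.
- move=> x Dx; rewrite ger0_norm ?sqr_ge0//.
  by rewrite -(real_normK (num_real (b x))) lerXn2r ?nnegrE// ?(le_trans _ (bC _ Dx)).
- apply: measurable_bounded_integrable => //.
  by exists `|C ^+ 2|; split; [rewrite num_real|move=> M CM x _; rewrite ltW].
Qed.

(** The sign of [c] decides where to evaluate: at the minimizer [- b / c] if [c] is positive, at a
    far point where the square dominates if [c] is negative, and, if [c = 0] while [b] is nonzero,
    where the affine function takes the value [-1]. *)
Lemma quadratic_discriminant (a b c : R) :
  (forall x, 0 <= a + 2 * x * b + x ^+ 2 * c) -> b ^+ 2 <= a * c.
Proof.
move=> q; have a0 := q 0; have [c0|c0|c0] := ltgtP c 0.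
- have [b0|b0] := leP b 0.
    have := q ((a + 1 - b) / - c + 1).
    have : 0 <= (a + 1 - b) / - c by apply: divr_ge0; nra.
    have : (a + 1 - b) / - c * - c = a + 1 - b by field; lra.
    by set z := _ / _ => z1 z2; nra.
  have := q (- ((a + 1 + b) / - c + 1)).
  have : 0 <= (a + 1 + b) / - c by apply: divr_ge0; nra.
  have : (a + 1 + b) / - c * - c = a + 1 + b by field; lra.
  by set z := _ / _ => z1 z2; nra.
- have := q (- b / c).
  have : - b / c * c = - b by field; lra.
  by set z := _ / _ => z1; nra.
- rewrite c0 mulr0; have [->|b0] := eqVneq b 0; first by rewrite expr0n.
  have := q (- (a + 1) / (2 * b)).
  have -> : a + 2 * (- (a + 1) / (2 * b)) * b + (- (a + 1) / (2 * b)) ^+ 2 * c = -1.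
    by rewrite c0; field.
  by lra.
Qed.

(** The squared norm of [f + t * g] is a nonnegative quadratic polynomial in [t]. *)
Lemma cauchy_schwarz f g : L2 f -> L2 g ->
  (\int[m]_(x in D) (f x * g x)) ^+ 2 <= N2 f * N2 g.
Proof.
move=> Lf Lg; apply: quadratic_discriminant => t.
have fg := L2_mul_integrable Lf Lg.
have := N2_ge0 (fun x => 1 * f x + t * g x); congr (0 <= _).
have [_ f2] := Lf; have [_ g2] := Lg.
rewrite /N2 (@eq_Rintegral _ _ _ m D (fun x => f x ^+ 2 +
    ((2 * t) * (f x * g x) + t ^+ 2 * g x ^+ 2))); last first.
  by move=> x _; ring.
have tfg := integrableRZ (2 * t) fg; have tg := integrableRZ (t ^+ 2) g2.
by rewrite !RintegralD// ?RintegralZl ?addrA//; exact: integrableRD.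
Qed.

Lemma parallelogram f g : L2 f -> L2 g ->
  N2 (fun x => f x - g x) =
  2 * N2 f + 2 * N2 g - 4 * N2 (fun x => 2^-1 * f x + 2^-1 * g x).
Proof.
move=> Lf Lg.
have [_ h2] := L2_linear 2^-1 2^-1 Lf Lg.
have [[mf f2] [mg g2]] := (Lf, Lg).
apply/eqP; rewrite eq_sym subr_eq; apply/eqP.
have [_ b2] := L2B Lf Lg.
have i1 := integrableRZ 2 f2; have i2 := integrableRZ 2 g2.
have i3 := integrableRZ 4 h2.
rewrite /N2 -!RintegralZl// -!RintegralD//.
by apply: eq_Rintegral => x _; field.
Qed.

Lemma N2_half f g : L2 f -> L2 g ->
  N2 (fun x => 2^-1 * f x + 2^-1 * g x) <= 2^-1 * N2 f + 2^-1 * N2 g.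
Proof.
by move=> Lf Lg; have := parallelogram Lf Lg; have := N2_ge0 (fun x => f x - g x); lra.
Qed.

Lemma N2_integral g : L2 g -> (\int[m]_(x in D) (g x ^+ 2)%:E)%E = (N2 g)%:E.
Proof.
by move=> [mg g2]; rewrite /N2 /Rintegral fineK//; exact: integrable_fin_num.
Qed.

Lemma L2_lty g : measurable_fun D g ->
  (\int[m]_(x in D) (g x ^+ 2)%:E < +oo)%E -> L2 g.
Proof.
move=> mg g2; split=> //; apply/integrableP; split.
  by apply/measurable_EFinP; exact: measurable_funX.
by under eq_integral => x _ do rewrite /= ger0_norm ?sqr_ge0//.
Qed.

End square_integrable_functions.

(** * Real sequences with geometrically decaying increments *)

Section fast_cauchy_sequences.
Variable R : realType.
Implicit Types a : nat -> R.

(** Induction on [k] with [(u + v) ^+ 2 <= 2 * u ^+ 2 + 2 * v ^+ 2]: the factor 2 lost at each step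
    is paid for by the prefactor, which doubles from [n.+1] to [n]. *)
Lemma sqr_dist_le_sum a n k : (a (n + k)%N - a n) ^+ 2 <=
  2 * (2 ^+ n)^-1 * \sum_(i < k) 2 ^+ (n + i) * (a (n + i).+1 - a (n + i)%N) ^+ 2.
Proof.
elim: k n => [|k IH] n; first by rewrite addn0 subrr expr0n big_ord0 mulr0.
rewrite big_ord_recl addn0 mulrDr.
under eq_bigr => i _ do rewrite /= /bump /= add1n addnS -addSn.
have := IH n.+1; rewrite addSn -addnS.
set s := \sum_(i < k) _; set p := a (n + k.+1)%N; set q := a n.+1.
have e0 : (2 : R) ^+ n != 0 by rewrite expf_neq0.
have -> : 2 * (2 ^+ n.+1)^-1 * s = (2 ^+ n)^-1 * s by rewrite exprS invfM; field.
have -> : 2 * (2 ^+ n)^-1 * (2 ^+ n * (q - a n) ^+ 2) = 2 * (q - a n) ^+ 2 by field.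
have -> : 2 * (2 ^+ n)^-1 * s = 2 * ((2 ^+ n)^-1 * s) by rewrite mulrA.
by have := sqr_ge0 ((p - q) - (q - a n)); nra.
Qed.

Lemma sqr_dist_cvg a C :
  (forall n k, (a (n + k)%N - a n) ^+ 2 <= C * (2 ^+ n)^-1) ->
  exists2 l, a @ \oo --> l & forall n, (a n - l) ^+ 2 <= C * (2 ^+ n)^-1.
Proof.
move=> aC.
have : cvg (a @ \oo).
  apply: cauchy_cvg; apply: cauchy_exP => e e0.
  have h : C * (2 ^+ n)^-1 @[n --> \oo] --> (C * 0 : R).
    apply: cvgMr; under eq_fun do rewrite -exprVn.
    by apply: cvg_expr; rewrite ger0_norm ?invr_ge0// invf_lt1// ltr1n.
  have e2 : C * 0 < e ^+ 2 by rewrite mulr0 exprn_gt0.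
  have [n _ /(_ n (leqnn _)) Cn] := cvgr_lt _ h _ e2.
  exists (a n); exists n => // k /= nk; rewrite /ball/= -(subnKC nk) distrC.
  rewrite -ltr_sqr ?nnegrE ?(ltW e0)// real_normK ?num_real//.
  exact: le_lt_trans (aC _ _) Cn.
move=> /cvg_ex[l al]; exists l => // n.
have : (a k - a n) ^+ 2 @[k --> \oo] --> (l - a n) ^+ 2.
  by under eq_fun do rewrite expr2; rewrite expr2; apply: cvgM; apply: cvgB => //; exact: cvg_cst.
rewrite -sqrrN opprB => /cvgr_to_le; apply.
by exists n => // k /= nk; rewrite -(subnKC nk) -(sqrrN (_ - a n)) opprB -sqrrN opprB.
Qed.

End fast_cauchy_sequences.

(** * Completeness of L2 and minimizing sequences in convex sets *)

Section square_integrable_completeness.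
Context {d : measure_display} {S : measurableType d} {R : realType}.
Variables (m : {measure set S -> \bar R}) (D : set S).
Hypothesis mD : measurable D.

(* The series [Z] of the [2 ^ k (v_(k+1) - v_k) ^ 2] is integrable, and where it
   is finite [(v_k - g) ^ 2 <= 2 ^ (1 - k) Z]: this dominates the error without
   Fatou's lemma. *)
Lemma L2_complete (v : nat -> S -> R) : (forall k, L2 m D (v k)) ->
  (forall k, N2 m D (fun x => v k.+1 x - v k x) <= (2 * 4 ^+ k)^-1) ->
  exists2 g, L2 m D g &
    forall k, N2 m D (fun x => v k x - g x) <= 2 * (2 ^+ k)^-1.
Proof.
move=> Lv vd.
pose w k x := 2 ^+ k * (v k.+1 x - v k x) ^+ 2.
have w0 k x : 0 <= w k x by rewrite mulr_ge0 ?sqr_ge0.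
have mv k : measurable_fun D (v k) by case: (Lv k).
have mw k : measurable_fun D (EFin \o w k).
  apply/measurable_EFinP; apply: measurable_funM => //.
  by apply: measurable_funX; exact: measurable_funB.
pose Z x := (\sum_(0 <= k <oo) (w k x)%:E)%E.
have mZ : measurable_fun D Z.
  apply: (@ge0_emeasurable_sum _ _ _ D (fun k x => (w k x)%:E) xpredT).
    by move=> k x _ _; rewrite lee_fin.
  by move=> k _; exact: mw.
have Z0 x : (0 <= Z x)%E by apply: nneseries_ge0 => *; rewrite lee_fin.
(* The term of index [k] has integral at most [2 ^+ k / (2 * 4 ^+ k)], and these bounds sum to 1. *)
have iZ : (\int[m]_(x in D) Z x <= 1)%E.
  rewrite integral_nneseries//; last by move=> *; rewrite lee_fin.
  have := @cvg_geometric_eseries_half R 1 0.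
  rewrite expr0 invr1 mulr1 => /cvg_lim <- //.
  apply: lee_nneseries => [k *|k *]; first by apply: integral_ge0 => x _; rewrite lee_fin.
  have Lk := L2B mD (Lv k.+1) (Lv k).
  have -> : (\int[m]_(x in D) (w k x)%:E = (2 ^+ k)%:E *
      \int[m]_(x in D) ((v k.+1 x - v k x) ^+ 2)%:E)%E.
    apply: (@ge0_integralZl_EFin _ _ _ m D mD
        (fun x => ((v k.+1 x - v k x) ^+ 2)%:E)) => //.
      by move=> x _; rewrite lee_fin sqr_ge0.
    by apply/measurable_EFinP; apply: measurable_funX; exact: measurable_funB.
  rewrite (N2_integral mD Lk) -EFinM lee_fin addn1 natrX.
  apply: (le_trans (ler_wpM2l _ (vd k))) => //.
  have -> : (4 : R) ^+ k = 2 ^+ k * 2 ^+ k by rewrite -exprMn; congr (_ ^+ _); ring.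
  by rewrite exprS div1r !invfM mulrCA mulVKf ?expf_neq0.
pose E := D `&` [set x | Z x \is a fin_num].
have mE : measurable E by exact: emeasurable_fin_num.
have aeE : {ae m, forall x, D x -> E x}.
  have /integrable_ae : m.-integrable D Z.
    apply/integrableP; split => //.
    by under eq_integral do rewrite gee0_abs//; exact: le_lt_trans iZ (ltry _).
  by move=> /(_ mD); apply: filterS => x Zx Dx; split=> //; exact: Zx.
have vE x : E x -> forall n k, (v (n + k)%N x - v n x) ^+ 2 <= (2 * fine (Z x)) * (2 ^+ n)^-1.
  move=> [Dx fZ] n k; apply: le_trans (sqr_dist_le_sum (v ^~ x) n k) _.
  rewrite [leRHS]mulrAC ler_wpM2l ?mulr_ge0//.
  rewrite -lee_fin fineK//; apply: le_trans (nneseries_lim_ge (n + k) _); last first.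
    by move=> *; rewrite lee_fin.
  by rewrite sumEFin lee_fin big_mkord big_split_ord /= lerDr sumr_ge0.
have lE x : exists l, E x -> v n x @[n --> \oo] --> l /\
    forall n, (v n x - l) ^+ 2 <= (2 * fine (Z x)) * (2 ^+ n)^-1.
  have [Ex|nEx] := pselect (E x); last by exists 0.
  by have [l al bl] := sqr_dist_cvg (vE x Ex); exists l.
have [l lP] := choice lE.
(* With the cutoff outside [E], [g] is the limit at every point of [D] of the measurable functions
   [(v n) \_ E], hence measurable. *)
pose g := l \_ E.
have mg : measurable_fun D g.
  apply: (@measurable_fun_cvg _ _ _ _ (fun n => (v n) \_ E)) => [k|x Dx].
    by apply/measurable_restrict => //; apply: measurable_funS (mv k).
  rewrite /g !patchE; case: ifPn => [/set_mem Ex|nEx].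
    have [h _] := lP _ Ex; apply: cvg_trans h; apply: near_eq_cvg.
    by apply: nearW => k; rewrite patchE mem_set.
  apply: (cvg_trans _ (@cvg_cst _ (0 : R) _ \oo _)); apply: near_eq_cvg.
  by apply: nearW => k; rewrite patchE (negbTE nEx).
have gb k : (\int[m]_(x in D) ((v k x - g x) ^+ 2)%:E <= (2 * (2 ^+ k)^-1)%:E)%E.
  apply: (@le_trans _ _ (\int[m]_(x in D) ((2 * (2 ^+ k)^-1)%:E * Z x))%E).
    apply: ae_ge0_le_integral => //.
    - by move=> x _; rewrite lee_fin sqr_ge0.
    - by apply/measurable_EFinP; apply: measurable_funX; exact: measurable_funB.
    - by move=> x _; rewrite mule_ge0// lee_fin.
    - by apply: emeasurable_funM.
    apply: filterS aeE => x /[apply] Ex; have [_ /(_ k)] := lP _ Ex.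
    have [_ fZ] := Ex.
    by rewrite /g patchE mem_set// -(fineK fZ) -EFinM lee_fin [leRHS]mulrAC.
  by rewrite ge0_integralZl ?lee_fin// -[leRHS]mule1 lee_wpmul2l// lee_fin.
have Ld k : L2 m D (fun x => v k x - g x).
  apply: L2_lty => //; first exact: measurable_funB.
  exact: le_lt_trans (gb k) (ltry _).
exists g => [|k]; last by rewrite -lee_fin -N2_integral.
apply: (@L2_ext _ _ _ m D mD (fun x => v 0%N x - (v 0%N x - g x))).
  by move=> x _; rewrite subKr.
exact: L2B.
Qed.

Lemma L2_cauchy (v : nat -> S -> R) : (forall k, L2 m D (v k)) ->
  (forall k l, (k <= l)%N ->
    N2 m D (fun x => v l x - v k x) <= (2 * 4 ^+ k)^-1) ->
  exists2 g, L2 m D g &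
    forall e, 0 < e -> \forall k \near \oo, N2 m D (fun x => v k x - g x) < e.
Proof.
move=> Lv vd.
have [g Lg gv] := L2_complete Lv (fun k => vd k k.+1 (leqnSn k)).
exists g => // e e0.
have h : 2 * (2 ^+ n)^-1 @[n --> \oo] --> (2 * 0 : R).
  apply: cvgMr; under eq_fun do rewrite -exprVn.
  by apply: cvg_expr; rewrite ger0_norm ?invr_ge0// invf_lt1// ltr1n.
have e1 : 2 * 0 < e by rewrite mulr0.
near=> k; apply: le_lt_trans (gv k) _; near: k; exact: (cvgr_lt _ h _ e1).
Unshelve. all: by end_near. Qed.

(* Minimizers of the norm over the sets are Cauchy by the parallelogram law,
   since the minimal norms increase and are bounded. *)
Lemma decreasing_convex_limit (C : nat -> set ((S -> R) * (S -> R))) B :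
  (forall n, C n !=set0) ->
  (forall k n, (k <= n)%N -> C n `<=` C k) ->
  (forall n p, C n p ->
    [/\ L2 m D p.1, L2 m D p.2 & N2 m D p.1 + N2 m D p.2 <= B]) ->
  (forall n p q, C n p -> C n q ->
    C n (fun x => 2^-1 * p.1 x + 2^-1 * q.1 x, fun x => 2^-1 * p.2 x + 2^-1 * q.2 x)) ->
  exists g u, [/\ L2 m D g, L2 m D u & forall n e, 0 < e -> exists2 p, C n p &
    N2 m D (fun x => p.1 x - g x) < e /\ N2 m D (fun x => p.2 x - u x) < e].
Proof.
move=> C0 Cdec CL Cmid.
pose Q (p : (S -> R) * (S -> R)) := N2 m D p.1 + N2 m D p.2.
have Q0 p : 0 <= Q p by rewrite addr_ge0// N2_ge0.
pose dn n := inf (Q @` C n).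
have lbQ n : has_lbound (Q @` C n) by exists 0 => _ [p _ <-].
have infQ n : has_inf (Q @` C n).
  by split => //; have [p Cp] := C0 n; exists (Q p), p.
have dnB n : dn n <= B.
  have [p Cp] := C0 n; apply: (@le_trans _ _ (Q p)).
    by apply: ge_inf => //; exists p.
  by have [] := CL _ _ Cp.
pose dd := sup (range dn).
have supd : has_sup (range dn).
  by split; [exists (dn 0%N), 0%N|exists B => _ [n _ <-]].
(* One eighth of the target distance: for [k <= l] the parallelogram law bounds the distance by [2 *
   (dd + th k) + 2 * (dd + th l) - 4 * (dd - th k)], which is at most [8 * th k]. *)
pose th k : R := (2 * 4 ^+ k)^-1 / 8.
have th0 k : 0 < th k by rewrite divr_gt0// invr_gt0 mulr_gt0// exprn_gt0.
have thle k l : (k <= l)%N -> th l <= th k.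
  move=> kl; rewrite ler_pM2r ?invr_gt0//.
  by rewrite lef_pV2 ?posrE ?mulr_gt0 ?exprn_gt0// ler_pM2l// ler_weXn2l// ler1n.
have pick k : exists np : nat * ((S -> R) * (S -> R)),
    [/\ (k <= np.1)%N, C np.1 np.2, dd - th k < dn np.1 & Q np.2 <= dd + th k].
  have [_ [n _ <-] nd] := sup_adherent (th0 k) supd.
  pose N := maxn k n.
  have dnN : dn n <= dn N.
    apply: lb_le_inf => [|_ [p Cp <-]]; first by case: (infQ N).
    by apply: ge_inf => //; exists p => //; apply: Cdec Cp; exact: leq_maxr.
  have [_ [p Cp <-] pd] := inf_adherent (th0 k) (infQ N).
  exists (N, p); split => //=; [exact: leq_maxl|exact: lt_le_trans dnN|].
  apply: ltW; apply: (lt_le_trans pd); rewrite lerD2r.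
  by apply: sup_ubound; [case: supd|exists N].
have [np npP] := choice pick.
pose a k := (np k).2.
have Ca k : C (np k).1 (a k) by case: (npP k).
have La1 k : L2 m D (a k).1 by case: (CL _ _ (Ca k)).
have La2 k : L2 m D (a k).2 by case: (CL _ _ (Ca k)).
have ad k l : (k <= l)%N -> N2 m D (fun x => (a l).1 x - (a k).1 x) +
    N2 m D (fun x => (a l).2 x - (a k).2 x) <= (2 * 4 ^+ k)^-1.
  move=> kl; rewrite !parallelogram//.
  have [h1 _ h2 h3] := npP k; have [h4 _ h5 h6] := npP l.
  have tkl := thle _ _ kl.
  (* Both near-minimizers lie in the larger set [C N], hence so does their midpoint, whose norm is
     therefore at least [dn N]. *)
  pose N := minn (np k).1 (np l).1.
  have dN : dd - th k <= dn N.
    rewrite /N /minn; case: ifP => _; first exact: ltW.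
    by apply: le_trans (ltW h5); lra.
  have Ck : C N (a k) by apply: Cdec (Ca k); exact: geq_minl.
  have Cl : C N (a l) by apply: Cdec (Ca l); exact: geq_minr.
  have := ge_inf (lbQ N) (ex_intro2 _ _ _ (Cmid _ _ _ Cl Ck) erefl).
  move: h3 h6; rewrite -/(dn N) -/(a k) -/(a l) /Q /=.
  have : (2 * 4 ^+ k)^-1 = 8 * th k by rewrite /th; field; rewrite expf_neq0.
  by move=> ->; lra.
have [g Lg gP] : exists2 g, L2 m D g & forall e, 0 < e ->
    \forall k \near \oo, N2 m D (fun x => (a k).1 x - g x) < e.
  apply: (@L2_cauchy (fun k => (a k).1)) => // k l /ad; apply: le_trans.
  by rewrite lerDl N2_ge0.
have [u Lu uP] : exists2 u, L2 m D u & forall e, 0 < e ->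
    \forall k \near \oo, N2 m D (fun x => (a k).2 x - u x) < e.
  apply: (@L2_cauchy (fun k => (a k).2)) => // k l /ad; apply: le_trans.
  by rewrite lerDr N2_ge0.
exists g, u; split=> // n e e0.
near \oo => k; exists (a k).
  by apply: Cdec (Ca k); case: (npP k) => + _ _ _; apply: leq_trans; near: k; exact: nbhs_infty_ge.
by split; near: k; [exact: gP|exact: uP].
Unshelve. all: by end_near. Qed.

End square_integrable_completeness.

(** * Absolutely continuous functions *)

Section absolutely_continuous_functions.
Variable R : realType.
Local Notation leb := (@lebesgue_measure R).
Implicit Types (a b c d e t x y : R) (H f : R -> R).

(** Continuous induction: the supremum of the points that [P] reaches from [a] is itself reached,
    and it cannot lie below [b] because [P] holds on small intervals around it. *)
Lemma cousin (P : R -> R -> Prop) a b : a <= b ->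
  (forall l c r, a <= l -> l <= c -> c <= r -> r <= b -> P l c -> P c r -> P l r) ->
  (forall x, a <= x <= b -> exists2 d : R, 0 < d & forall l r,
     a <= l -> l <= x -> x <= r -> r <= b -> x - d < l -> r < x + d -> P l r) ->
  P a b.
Proof.
move=> ab Pcat Ploc.
pose S := [set x | a <= x <= b /\ P a x].
have Sa : S a.
  split; first by rewrite lexx.
  by have [|d d0] := Ploc a; [rewrite lexx|apply=> //; lra].
have supS : has_sup S by split; [exists a|exists b => x [/andP[]]].
set c := sup S.
have ac : a <= c by apply: sup_ubound => //; case: supS.
have cb : c <= b by apply: ge_sup; [exists a|move=> x [/andP[]]].
have [|d d0 Pc] := Ploc c; first by rewrite ac.
have [x [/andP[ax xb] Pax] cx] := sup_adherent d0 supS.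
have xc : x <= c by apply: sup_ubound; [case: supS|split=> //; rewrite ax].
have Pc' r : c <= r -> r <= b -> r < c + d -> P a r.
  by move=> cr rb rd; apply: (Pcat _ x) => //; [lra|apply: Pc].
have [cb'|] := ltP c b; last by move=> bc; apply: Pc' => //; lra.
pose r := Num.min b (c + d / 2).
have cr : c < r by rewrite lt_min cb'/= ltrDl divr_gt0.
have rb : r <= b by rewrite ge_min lexx.
have rd : r < c + d by rewrite gt_min; apply/orP; right; lra.
suff : r <= c by rewrite leNgt cr.
apply: sup_ubound; first by case: supS.
by split; [rewrite rb andbT; lra|apply: Pc' => //; exact: ltW].
Qed.

Lemma sum_integral_disjoint n (l r : 'I_n -> R) (D : set R) (g : R -> \bar R) :
  measurable D -> trivIset setT (fun i => `]l i, r i[%classic) ->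
  (forall i, `]l i, r i[%classic `<=` D) ->
  measurable_fun D g -> (forall x, D x -> (0 <= g x)%E) ->
  (\sum_(i < n) \int[leb]_(x in `]l i, r i[) g x <= \int[leb]_(x in D) g x)%E.
Proof.
move=> mD tr sub mg g0.
have subU : \big[setU/set0]_(i < n) `]l i, r i[%classic `<=` D.
  by apply: (big_ind (fun X : set R => X `<=` D)) => // X Y XD YD x [/XD|/YD].
have mU : measurable (\big[setU/set0]_(i < n) `]l i, r i[%classic : set R).
  by apply: bigsetU_measurable => i _.
rewrite -ge0_integral_bigsetU//.
- exact: ge0_subset_integral.
- exact: index_enum_uniq.
- by apply: sub_trivIset tr.
- exact: measurable_funS mg.
- by move=> x /subU; exact: g0.
Qed.

Lemma sum_length_disjoint n (l r : 'I_n -> R) (D : set R) :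
  measurable D -> trivIset setT (fun i => `]l i, r i[%classic) ->
  (forall i, l i <= r i) ->
  (forall i, `]l i, r i[%classic `<=` D) ->
  ((\sum_(i < n) (r i - l i))%:E <= leb D)%E.
Proof.
move=> mD tr lr sub; rewrite -(mul1e (leb D)) -integral_cst//.
apply: le_trans (sum_integral_disjoint mD tr sub _ _) => //.
rewrite -sumEFin; apply: lee_sum => i _.
rewrite integral_cst// mul1e; have [lri|rli] := ltP (l i) (r i).
  have := @lebesgue_measure_itv R `]l i, r i[; rewrite /= lte_fin lri => ->.
  by rewrite EFinB.
apply: le_trans (measure_ge0 _ _).
by rewrite lee_fin subr_le0.
Qed.

Lemma derive1_cvg f x : derivable f x 1 ->
  h^-1 * (f (h + x) - f x) @[h --> 0^'] --> derive1 f x.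
Proof.
move=> df; rewrite derive1E; have := df => /cvgP.
have : h^-1 *: ((f \o shift x) (h *: (1 : R)) - f x) @[h --> 0^'] --> 'D_1 f x.
  exact: df.
by under eq_fun do rewrite /= /shift /GRing.scale /= mulr1.
Qed.

Lemma derive1_eq0_bound f x e : 0 < e -> derivable f x 1 -> derive1 f x = 0 ->
  exists2 d : R, 0 < d & forall y, `|y - x| < d -> `|f y - f x| <= e * `|y - x|.
Proof.
move=> e0 /derive1_cvg + f0; rewrite f0 => /cvgr0_norm_lt /(_ _ e0).
move=> /nbhs_ballP[d/= d0 dP]; exists d => // y yd.
have [->|yx] := eqVneq y x; first by rewrite !subrr normr0 mulr0.
have := dP (y - x); rewrite /ball /= sub0r normrN => /(_ yd).
rewrite subr_eq0 => /(_ yx); rewrite subrK normrM normfV => h.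
have n0 : 0 < `|y - x| by rewrite normr_gt0 subr_eq0.
by rewrite -ler_pdivrMr// mulrC ltW.
Qed.

(* Cousin's lemma for the gauge given by differentiability off a null set and
   by an open superset of small measure on it. *)
Lemma ac_derive1_eq0_cst (T : R) H t : absolutely_continuous T H ->
  {ae leb, forall x, x \in `]0, T[ -> derivable H x 1 /\ derive1 H x = 0} ->
  t \in `[0, T] -> H t = H 0.
Proof.
move=> acH aeH; rewrite in_itv/= => /andP[t0 tT].
suff small e : 0 < e -> `|H t - H 0| <= e.
  apply/eqP; rewrite -subr_eq0 -normr_le0; apply/ler_addgt0Pr => e e0.
  by rewrite add0r small.
(* Half of [e] is spent on the slope [e'] over an interval of length [t], the other half on the
   increments over a set of measure less than [d]. *)
move=> e0; pose e' : R := e / (2 * (t + 1)).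
have e'0 : 0 < e' by rewrite divr_gt0// mulr_gt0//; lra.
have [d d0 dP] := acH _ (divr_gt0 e0 (ltr0n _ 2)).
have [A [mA A0 subA]] := aeH.
(* The endpoints join the exceptional set because differentiability is known only in the open
   interval. *)
pose N := A `|` [set 0; T].
have mN : measurable N by apply: measurableU => //; apply: measurableU.
have N0 : leb N = 0.
  apply/eqP; rewrite -measure_le0.
  apply: le_trans (measureU2 _ _ _) _ => //; first exact: measurableU.
  rewrite [X in (X + _)%E](_ : _ = 0%E)// add0e.
  apply: le_trans (measureU2 _ _ _) _ => //.
  rewrite -[leRHS]adde0; apply: leeD; rewrite le_eqVlt; apply/orP; left.
    by apply/eqP; exact: lebesgue_measure_set1.
  by apply/eqP; exact: lebesgue_measure_set1.
have muN : (leb N < +oo)%E by rewrite N0.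
have [U [oU NU Ud]] := lebesgue_regularity_outer mN muN d0.
have mU : measurable U by exact: open_measurable.
have muU : (leb U < d%:E)%E.
  apply: le_lt_trans Ud; rewrite -[leRHS]adde0 -N0 -[X in (leb X <= _)%E](@setDUK _ N U)//.
  by rewrite setUC; apply: measureU2 => //; exact: measurableD.
(* The increment of [H] over [[l, r]] splits into a part of slope at most [e'] and the increments
   over finitely many ordered, non-overlapping intervals inside [U]. Concatenating the lists gives
   additivity. *)
pose P l r := exists s : seq (R * R),
  [/\ all (fun p => [&& l <= p.1, p.1 <= p.2 & p.2 <= r]) s,
      pairwise (fun p q : R * R => p.2 <= q.1) s,
      (forall p, p \in s -> `]p.1, p.2[%classic `<=` U) &
      `|H r - H l| <= e' * (r - l) + \sum_(p <- s) `|H p.2 - H p.1|].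
have [s [slr sp sU sH]] : P 0 t.
  apply: cousin => //.
    move=> l c r _ lc cr _ [s1 [h1 p1 u1 b1]] [s2 [h2 p2 u2 b2]].
    exists (s1 ++ s2); split.
    - rewrite all_cat; apply/andP; split.
        by apply: sub_all h1 => p /and3P[-> -> /le_trans]; apply.
      by apply: sub_all h2 => p /and3P[/(le_trans lc) -> -> ->].
    - rewrite pairwise_cat p1 p2 !andbT; apply/allrelP => p q ps qs.
      have /and3P[_ _ pc] := allP h1 _ ps; have /and3P[cq _ _] := allP h2 _ qs.
      exact: le_trans cq.
    - by move=> p; rewrite mem_cat => /orP[/u1|/u2].
    - rewrite big_cat/=; have := ler_normD (H r - H c) (H c - H l).
      rewrite addrA subrK; set S1 := \sum_(_ <- _) _ in b1 *.
      by set S2 := \sum_(_ <- _) _ in b2 *; lra.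
  (* Near a point of [U] the list is the whole interval; near a point outside [U] it is empty, since
     [H] has derivative zero there. *)
  move=> x /andP[x0 xt]; have [Ux|nUx] := pselect (U x).
    have /nbhs_ballP[δ /= δ0 δU] : nbhs x U by rewrite openE in oU; exact: oU.
    exists δ => // l r l0 lx xr rt xl rx; exists [:: (l, r)]; split => //=.
    - by rewrite !lexx (le_trans lx xr).
    - move=> p; rewrite inE => /eqP -> y /=; rewrite in_itv/= => /andP[ly yr].
      by apply: δU; rewrite /ball /= ltr_norml; apply/andP; split; lra.
    - by rewrite big_seq1 /= lerDr mulr_ge0//; [exact: ltW|lra].
  have [nAx x0T] : ~ A x /\ x \in `]0, T[.
    split; first by move=> Ax; apply: nUx; apply: NU; left.
    rewrite in_itv/= !lt_neqAle x0 (le_trans xt tT) !andbT; apply/andP; split.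
      by apply/eqP => x0'; apply: nUx; apply: NU; right; left.
    by apply/eqP => xT; apply: nUx; apply: NU; right; right.
  have [dH H0] : derivable H x 1 /\ derive1 H x = 0.
    by apply: contrapT => nH; apply: nAx; apply: subA => /= /(_ x0T).
  have [δ δ0 δP] := derive1_eq0_bound e'0 dH H0.
  exists δ => // l r l0 lx xr rt xl rx; exists [::]; split => //=.
  rewrite big_nil addr0.
  have h1 : `|r - x| < δ by rewrite ger0_norm; lra.
  have h2 : `|l - x| < δ by rewrite ler0_norm; lra.
  have := δP _ h1; have := δP _ h2.
  rewrite (ger0_norm (_ : 0 <= r - x)) ?subr_ge0// (ler0_norm (_ : l - x <= 0)) ?subr_le0//.
  have := ler_normB (H r - H x) (H l - H x).
  by rewrite opprB addrA subrK; lra.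
apply: (le_trans sH).
have -> : e = e / 2 + e / 2 by field.
apply: lerD.
  have : e' * (2 * (t + 1)) = e by rewrite /e' divfK// gt_eqF// mulr_gt0//; lra.
  by rewrite subr0; lra.
pose z : R * R := (0, 0).
rewrite (big_nth z) big_mkord ltW//.
have nthP (i : 'I_(size s)) := allP slr _ (mem_nth z (ltn_ord i)).
have tr : trivIset setT (fun i : 'I_(size s) => `](nth z s i).1, (nth z s i).2[%classic).
  have lem (i j : 'I_(size s)) x : (i < j)%N ->
     x \in `](nth z s i).1, (nth z s i).2[ -> x \in `](nth z s j).1, (nth z s j).2[ -> False.
    move=> ij; rewrite !in_itv/= => /andP[_ h1] /andP[h2 _].
    have /(pairwiseP z) := sp => /(_ i j); rewrite !inE !ltn_ord => /(_ erefl erefl ij).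
    lra.
  move=> i j _ _ [x [xi xj]]; have [ij|ij|/val_inj//] := ltngtP i j.
    by have := lem _ _ _ ij xi xj.
  by have := lem _ _ _ ij xj xi.
apply: dP => //.
- move=> i; have /and3P[h1 h2 h3] := nthP i.
  by split => //; exact: le_trans h3 tT.
- rewrite -lte_fin; apply: le_lt_trans muU; apply: sum_length_disjoint => // i.
    by have /and3P[] := nthP i.
  by apply: sU; exact: mem_nth.
Qed.

End absolutely_continuous_functions.

(** * Primitives of square integrable functions *)

Section primitives.
Variable R : realType.
Local Notation leb := (@lebesgue_measure R).
Implicit Types (T l r t x : R) (F h g : R -> R).

Lemma itv_lty T : (leb `[0%R, T]%classic < +oo)%E.
Proof.
by have := @lebesgue_measure_itv R `[0, T]; rewrite /= => ->; case: ifP => _; rewrite ?ltry.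
Qed.

Lemma L2_integrable T h : L2 leb `[0, T] h -> leb.-integrable `[0, T] (EFin \o h).
Proof.
move=> Lh; have L1 : L2 leb `[0, T] (cst 1).
  by apply: (@L2_bounded _ _ _ _ _ _ _ 1) => //; [exact: itv_lty|move=> x _; rewrite /= normr1].
apply: eq_integrable (L2_mul_integrable _ L1 Lh) => // x _.
by rewrite /= mul1r.
Qed.

Lemma Rintegral_itv_diff T h l r : leb.-integrable `[0, T] (EFin \o h) ->
  0 <= l -> l <= r -> r <= T ->
  \int[leb]_(x in `[0, r]) h x - \int[leb]_(x in `[0, l]) h x =
  \int[leb]_(x in `]l, r[) h x.
Proof.
move=> ih l0 lr rT.
have i1 : leb.-integrable `[0, r] (EFin \o h).
  by apply: integrableS ih => //; apply: subset_itvl; rewrite bnd_simp.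
rewrite Rintegral_itvB// Rintegral_itv_bndo_bndc//.
by apply: integrableS i1 => //; apply: subset_itv; rewrite bnd_simp.
Qed.

(** Since [|h| <= q * h ^+ 2 + (4 * q)^-1], the increments over disjoint intervals of total length
    [s] add up to at most [q * N + s / (4 * q)], where [N] is the squared norm of [h]. *)
Lemma primitive_ac T h F : L2 leb `[0, T] h ->
  (forall t, t \in `[0, T] -> F t = \int[leb]_(s in `[0, t]) h s) ->
  absolutely_continuous T F.
Proof.
move=> Lh Fh e e0.
have ih := L2_integrable Lh; have [mh h2] := Lh.
pose N := N2 leb `[0, T] h; have N0 : 0 <= N := N2_ge0 _ _ _.
(* This makes [q * N] at most [e / 2], and the length [2 * e * q] allowed below makes the other term
   less than [e / 2]. *)
pose q := e / (2 * (N + 1)).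
have q0 : 0 < q by rewrite divr_gt0// mulr_gt0//; lra.
exists (2 * e * q); first by rewrite mulr_gt0// mulr_gt0.
move=> n l r lr tr len.
have sub i : `]l i, r i[%classic `<=` (`[0, T]%classic : set R).
  by have [h1 _ h3] := lr i; apply: subset_itv; rewrite bnd_simp.
have bound i : `|F (r i) - F (l i)| <=
    q * \int[leb]_(x in `]l i, r i[) (h x ^+ 2) + (4 * q)^-1 * (r i - l i).
  have [l0 lri rT] := lr i.
  rewrite !Fh ?in_itv/= ?l0 ?rT ?(le_trans l0 lri) ?(le_trans lri rT)//.
  rewrite (Rintegral_itv_diff ih)//.
  have ihi : leb.-integrable `]l i, r i[ (EFin \o h) by apply: integrableS ih.
  have h2i : leb.-integrable `]l i, r i[ (EFin \o (fun x => h x ^+ 2)) by apply: integrableS h2.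
  have ci : leb.-integrable `]l i, r i[ (EFin \o (fun=> 1 : R)).
    apply: measurable_bounded_integrable => //.
      apply: le_lt_trans (itv_lty T); apply: le_measure; rewrite ?inE//.
    by exists 1; split => // M M1 x _; rewrite /= normr1 ltW.
  have i1 : leb.-integrable `]l i, r i[ (EFin \o (fun x => q * h x ^+ 2)).
    exact: integrableRZ.
  have i2 : leb.-integrable `]l i, r i[ (EFin \o (fun=> (4 * q)^-1 * 1)).
    exact: integrableRZ.
  have -> : r i - l i = \int[leb]_(x in `]l i, r i[) 1.
    rewrite Rintegral_cst// mul1r.
    have := @lebesgue_measure_itv R `]l i, r i[; rewrite /= => ->.
    by rewrite lte_fin; case: ltP => // ?; rewrite /=; lra.
  rewrite -!RintegralZl// -RintegralD//.
  apply: le_trans (le_normr_Rintegral _ _) _ => //.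
  apply: le_Rintegral => //; first exact: integrable_norm.
    exact: integrableRD.
  move=> x _.
  have q2 : q * (4 * q)^-1 = 4^-1 by field; rewrite gt_eqF.
  have z0 : 0 < (4 * q)^-1 by rewrite invr_gt0 mulr_gt0.
  rewrite mulr1 -(real_normK (num_real (h x))).
  set z := (4 * q)^-1 in q2 z0 *; set w := `|h x|.
  have e1 : z * (q * (w * 2) - 1) ^+ 2 = q * w ^+ 2 - w + z.
    have -> : z * (q * (w * 2) - 1) ^+ 2 = 4 * (q * z) * q * w ^+ 2 - 4 * (q * z) * w + z by ring.
    by rewrite q2; field.
  have : 0 <= z * (q * (w * 2) - 1) ^+ 2 by rewrite mulr_ge0 ?sqr_ge0 ?ltW.
  by rewrite e1; lra.
apply: le_lt_trans (ler_sum _ (fun i _ => bound i)) _.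
rewrite big_split/= -!mulr_sumr.
have sN : \sum_(i < n) \int[leb]_(x in `]l i, r i[) (h x ^+ 2) <= N.
  rewrite -lee_fin -sumEFin -N2_integral//.
  have := @sum_integral_disjoint R n l r _ (fun x => (h x ^+ 2)%:E) (measurable_itv `[0, T]) tr sub.
  have mh2 : measurable_fun `[0, T] (fun x => (h x ^+ 2)%:E).
    by apply/measurable_EFinP; exact: measurable_funX.
  move=> /(_ mh2) sd; apply: le_trans (sd _); last by move=> x _; rewrite lee_fin sqr_ge0.
  apply: lee_sum => i _; rewrite /Rintegral fineK//.
  by apply: integrable_fin_num => //; apply: integrableS h2.
have e1 : q * N <= e / 2.
  have : q * (2 * (N + 1)) = e by rewrite /q divfK// gt_eqF// mulr_gt0//; lra.
  by move: q0 => {}q0; lra.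
have e2 : (4 * q)^-1 * (2 * e * q) = e / 2 by field; rewrite gt_eqF.
have e3 : (4 * q)^-1 * \sum_(i < n) (r i - l i) < e / 2.
  by rewrite -e2 ltr_pM2l// invr_gt0 mulr_gt0.
have e4 : q * \sum_(i < n) \int[leb]_(x in `]l i, r i[) (h x ^+ 2) <= q * N.
  by rewrite ler_pM2l.
lra.
Qed.

Lemma near_eq_derive1 F g x : {near x, F =1 g} -> derivable F x 1 ->
  derivable g x 1 /\ derive1 g x = derive1 F x.
Proof.
move=> Fg dF; split; first exact: near_eq_derivable dF.
rewrite !derive1E; apply: near_eq_derive.
by apply: filterS Fg => y /esym.
Qed.

Lemma near_itv_oo T x : x \in `]0, T[ -> \forall y \near x, y \in `]0, T[.
Proof. by move=> xT; apply: near_in_itvoo. Qed.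

(** Lebesgue differentiation applies to the extension of [h] by zero, whose primitive agrees with
    [F] near every interior point. *)
Lemma primitive_derive1 T h F : leb.-integrable `[0, T] (EFin \o h) ->
  (forall t, t \in `[0, T] -> F t = \int[leb]_(s in `[0, t]) h s) ->
  {ae leb, forall t, t \in `]0, T[ -> derivable F t 1 /\ derive1 F t = h t}.
Proof.
move=> ih Fh; pose g := h \_ `[0, T].
have ig : leb.-integrable setT (EFin \o g).
  by rewrite /g -restrict_EFin; apply/(integrable_mkcond _ _).1.
have := @FTC1 R g (BLeft 0) _ _.
case=> [y||A [mA A0 sA]]; first by apply: integrableS ig.
  exact: integrable_locally.
exists A; split => // t /= nt; apply: sA => /= ht; apply: nt => tT.
have [|dg gt] := ht; first by move: tT; rewrite in_itv/= => /andP[].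
have [|d1 d2] := @near_eq_derive1 _ F t _ dg.
  apply: filterS (near_itv_oo tT) => y yT.
  have yT' : y \in `[0, T] by move: y yT; apply: subset_itvW.
  rewrite Fh//; apply: eq_Rintegral => s; rewrite inE/= => sy; rewrite /g patchE mem_set//=.
  move: sy yT'; rewrite !in_itv/= => /andP[-> sy] /andP[_]; exact: le_trans.
split=> //; rewrite d2 gt /g patchE mem_set//=.
by move: tT; rewrite !in_itv/= => /andP[/ltW -> /ltW ->].
Qed.

End primitives.

(** * Measurability of derivatives, and [H01] as a space of primitives *)

Section measurable_derivative.
Variable R : realType.
Local Notation leb := (@lebesgue_measure R).
Implicit Types (T e d t h k : R) (F x : R -> R).

(** The Cauchy criterion for the difference quotients at one scale; the weak inequality makes the
    set closed when [F] is continuous. *)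
Definition quotient_osc F (e d : R) : set R := [set t |
  forall h k, h != 0 -> k != 0 -> `|h| < d -> `|k| < d ->
    `|h^-1 * (F (h + t) - F t) - k^-1 * (F (k + t) - F t)| <= e].

(** An intersection, over all pairs of increments, of closed conditions on [t]; an inadmissible pair
    imposes no condition. *)
Lemma closed_quotient_osc F e d : continuous F -> closed (quotient_osc F e d).
Proof.
move=> cF.
pose A h k := [set t | h != 0 -> k != 0 -> `|h| < d -> `|k| < d ->
    `|h^-1 * (F (h + t) - F t) - k^-1 * (F (k + t) - F t)| <= e].
have -> : quotient_osc F e d = \bigcap_(p in @setT (R * R)) A p.1 p.2.
  apply/seteqP; split => t /= ht; first by move=> [h k] _ /=; exact: ht.
  by move=> h k; exact: (ht (h, k)).
apply: closed_bigI => -[h k] _ /=; rewrite /A.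
have [h0|h0] := boolP (h != 0); last first.
  by rewrite (_ : [set _ | _] = setT)//; do ?[exact: closedT|by apply/seteqP; split].
have [k0|k0] := boolP (k != 0); last first.
  by rewrite (_ : [set _ | _] = setT)//; do ?[exact: closedT|by apply/seteqP; split].
have [hd|hd] := boolP (`|h| < d); last first.
  by rewrite (_ : [set _ | _] = setT)//; do ?[exact: closedT|by apply/seteqP; split].
have [kd|kd] := boolP (`|k| < d); last first.
  by rewrite (_ : [set _ | _] = setT)//; do ?[exact: closedT|by apply/seteqP; split].
rewrite (_ : [set _ | _] = (fun t => `|h^-1 * (F (h + t) - F t) - k^-1 * (F (k + t) - F t)|) @^-1` [set y | y <= e]); last first.
  by apply/seteqP; split => t /=; [exact|move=> ? _ _ _ _].
apply: (@closed_comp R R) => [t _|]; last exact: closed_le.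
have c1 a : F (a + s) @[s --> t] --> F (a + t).
  apply: (@cvg_comp _ _ _ (fun s => a + s) F _ (nbhs (a + t))); last exact: cF.
  by apply: cvgD; [exact: cvg_cst|exact: cvg_id].
apply: cvg_norm; apply: cvgB; apply: cvgMr; apply: cvgB => //; exact: cF.
Qed.

Definition derivable_set F : set R :=
  \bigcap_n \bigcup_m quotient_osc F n.+1%:R^-1 m.+1%:R^-1.

Lemma measurable_derivable_set F : continuous F -> measurable (derivable_set F).
Proof.
move=> cF; apply: bigcap_measurable => [|n _]; first by exists 0%N.
apply: bigcup_measurable => m _.
by apply: closed_measurable; exact: closed_quotient_osc.
Qed.

Lemma derivable_setP F t :
  derivable_set F t <-> cvg (h^-1 * (F (h + t) - F t) @[h --> 0^']).
Proof.
split=> [Dt|/cvg_ex[l /= ql] n _].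
  apply: cauchy_cvg; apply: cauchy_exP => e e0.
  have [n ne] : exists n : nat, n.+1%:R^-1 < e.
    by have /= [n _ /(_ n (leqnn n))] := near_infty_natSinv_lt (PosNum e0); exists n.
  have [m _ tm] := Dt n I.
  pose h0 : R := m.+1%:R^-1 / 2.
  have m0 : 0 < m.+1%:R^-1 :> R by rewrite invr_gt0.
  have h00 : 0 < h0 by rewrite divr_gt0.
  exists (h0^-1 * (F (h0 + t) - F t)).
  apply/nbhs_ballP; exists m.+1%:R^-1 => //= k; rewrite /ball/= sub0r normrN => km k0.
  apply: le_lt_trans ne; apply: tm => //; first by rewrite gt_eqF.
  by rewrite gtr0_norm// /h0 ltr_pdivrMr// ltr_pMr// ltr1n.
have n0 : 0 < n.+1%:R^-1 / 2 :> R by rewrite divr_gt0.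
have /cvgrPdist_lt/(_ _ n0)/nbhs_ballP[d/= d0 dP] := ql.
have [m md] : exists m : nat, m.+1%:R^-1 < d.
  by have /= [m _ /(_ m (leqnn m))] := near_infty_natSinv_lt (PosNum d0); exists m.
exists m => // h k h0 k0 hm km.
have := dP h; rewrite /ball/= sub0r normrN => /(_ (lt_trans hm md) h0).
have := dP k; rewrite /ball/= sub0r normrN => /(_ (lt_trans km md) k0).
set a := k^-1 * _; set b := h^-1 * _ => h1 h2.
have := ler_distD l b a; rewrite (distrC b l).
by move: h1 h2; set N1 := n.+1%:R^-1; lra.
Qed.

(* Measurability is with respect to the Borel sets, which are not complete for
   the Lebesgue measure: the null set where [derive1] is junk must be shown to be
   Borel, it cannot be ignored. *)
Lemma measurable_derive1 F : continuous F -> measurable_fun setT (derive1 F).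
Proof.
move=> cF.
have mD := measurable_derivable_set cF.
(* [point] is the value of [derive1] where the difference quotients diverge. Subtracting it before
   the cutoff and adding it back afterwards gives the approximations that value off
   [derivable_set F]. *)
pose c : R := point.
pose q n t : R := (n.+1%:R^-1)^-1 * (F (n.+1%:R^-1 + t) - F t).
apply: (@measurable_fun_cvg _ _ _ _ (fun n t => ((fun t => q n t - c) \_ (derivable_set F)) t + c)) => [n|t _].
  apply: measurable_funD => //; apply/(measurable_restrictT _ _).1 => //.
  apply: (@measurable_funS _ _ _ _ setT) => //.
  apply: measurable_funB => //; apply: measurable_funM => //.
  have mF := continuous_measurable_fun cF.
  apply: measurable_funB => //; apply: (measurableT_comp mF).
  exact: measurable_funD.
have [Dt|nDt] := pselect (derivable_set F t); last first.
  have -> : derive1 F t = c by apply: dvgP => /derivable_setP.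
  rewrite (_ : (fun n => _) = cst c); first exact: cvg_cst.
  by apply/funext => n /=; rewrite patchE memNset// add0r.
have := Dt => /derivable_setP cD.
rewrite (_ : (fun n => _) = q ^~ t); last first.
  by apply/funext => n /=; rewrite patchE mem_set// subrK.
have := (cvgr_dnbhsP _ _ _).1 cD (fun n => n.+1%:R^-1); apply.
by split => [n|]; [rewrite gt_eqF|exact: cvg_harmonic].
Qed.

Lemma ac_uniform T F : absolutely_continuous T F -> forall e, 0 < e ->
  exists2 d : R, 0 < d & forall s t, s \in `[0, T] -> t \in `[0, T] ->
    `|s - t| < d -> `|F s - F t| < e.
Proof.
move=> acF e e0; have [d d0 dP] := acF e e0; exists d => // s t.
wlog st : s t / t <= s => [hw sT tT|].
  have [ts|/ltW ts] := leP t s; first exact: hw.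
  by rewrite distrC => std; rewrite distrC; apply: hw.
rewrite !in_itv/= => /andP[s0 sT] /andP[t0 tT]; rewrite ger0_norm ?subr_ge0// => std.
have := dP 1%N (fun=> t) (fun=> s); rewrite !big_ord1; apply => //.
by move=> i j _ _ _; rewrite !ord1.
Qed.

Definition clamp T t : R := if t < 0 then 0 else if T < t then T else t.

Lemma clamp_itv T t : 0 < T -> clamp T t \in `[0, T].
Proof.
by move=> T0; rewrite in_itv/= /clamp; case: ltP => t0; [|case: ltP => tT]; apply/andP; split; lra.
Qed.

Lemma clamp_id T t : t \in `[0, T] -> clamp T t = t.
Proof.
by rewrite in_itv/= /clamp => /andP[t0 tT]; case: ltP; [lra|case: ltP; lra].
Qed.

Lemma clamp_lip T s t : 0 < T -> `|clamp T s - clamp T t| <= `|s - t|.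
Proof.
move=> T0; have := ler_norm (s - t); have := ler_norm (t - s).
rewrite (distrC t) ler_norml /clamp.
by case: (ltP s 0) => ?; case: (ltP t 0) => ?; case: (ltP T s) => ?; case: (ltP T t) => ? ? ?;
  apply/andP; split; lra.
Qed.

(** Composition with [clamp T] extends [F] continuously to the line without changing its derivative
    inside the interval; the two endpoints do not affect measurability. *)
Lemma ac_measurable_derive1 T F : 0 < T -> absolutely_continuous T F ->
  measurable_fun `[0, T] (derive1 F).
Proof.
move=> T0 acF; pose G := F \o clamp T.
have cG : continuous G.
  move=> t; apply/cvgrPdist_lt => e e0.
  have [d d0 dP] := ac_uniform acF e0.
  apply/nbhs_ballP; exists d => // s; rewrite /ball/= => ts.
  by apply: dP; rewrite ?clamp_itv//; apply: le_lt_trans ts; exact: clamp_lip.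
have mG := measurable_derive1 cG.
apply: (@measurable_fun_itv_cc _ _ _ false true); apply: (eq_measurable_fun (derive1 G)).
  move=> t; rewrite inE/= => tT; rewrite !derive1E; apply: near_eq_derive.
  apply: filterS (near_itv_oo tT) => y; rewrite in_itv/= => /andP[y0 yT].
  by rewrite /G/= clamp_id// in_itv/= !ltW.
exact: measurable_funS mG.
Qed.

Lemma acB T F G : absolutely_continuous T F -> absolutely_continuous T G ->
  absolutely_continuous T (fun t => F t - G t).
Proof.
move=> acF acG e e0.
have e2 : 0 < e / 2 by rewrite divr_gt0.
have [d d0 dP] := acF _ e2; have [d' d'0 d'P] := acG _ e2.
exists (Num.min d d'); first by rewrite lt_min d0.
move=> n l r lr tr; rewrite lt_min => /andP[sd sd'].
have := dP n l r lr tr sd; have := d'P n l r lr tr sd'.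
set S1 := \sum_(i < n) _; set S2 := \sum_(i < n) _ => h1 h2.
apply: (@le_lt_trans _ _ (S2 + S1)); last by lra.
rewrite -big_split /=; apply: ler_sum => i _.
have -> : F (r i) - G (r i) - (F (l i) - G (l i)) = (F (r i) - F (l i)) - (G (r i) - G (l i)) by ring.
exact: ler_normB.
Qed.

Lemma H01_L2 T F : H01 T F -> L2 leb `[0, T] (derive1 F).
Proof. by case=> _ _ _ [mF F2]; exact: L2_lty. Qed.

(** The difference of [F] and the primitive of its derivative is absolutely continuous with
    derivative zero almost everywhere, hence constant. *)
Lemma H01_primitive T F t : H01 T F -> t \in `[0, T] ->
  F t = \int[leb]_(s in `[0, t]) (derive1 F s).
Proof.
move=> HF tT; have LF := H01_L2 HF; have [acF F0 aeF _] := HF.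
pose G t := \int[leb]_(s in `[0, t]) (derive1 F s).
have acG : absolutely_continuous T G by exact: (primitive_ac LF).
have aeG := primitive_derive1 (L2_integrable LF) (fun t _ => erefl (G t)).
have := @ac_derive1_eq0_cst _ T (fun t => F t - G t) t (acB acF acG) _ tT.
rewrite F0 /G set_itv1 Rintegral_set1 subr0 => h; apply/eqP; rewrite -subr_eq0; apply/eqP.
apply: h; apply: (@filterS2 _ _ (ae_filter_ringOfSetsType leb) _ _ _ _ aeF aeG) => x dF dG xT.
have [dG1 dG2] := dG xT; have dF1 := dF xT.
split; first exact: derivableB.
by rewrite derive1E deriveB// -!derive1E dG2 subrr.
Qed.

(** The converse: controls given as elements of L2 become paths in [H01]. The derivative equals [h]
    only almost everywhere, so its measurability is obtained separately, from absolute
    continuity. *)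
Lemma H01_of_primitive T F (h : R -> R) : 0 < T -> L2 leb `[0, T] h ->
  (forall t, t \in `[0, T] -> F t = \int[leb]_(s in `[0, t]) h s) ->
  H01 T F /\ {ae leb, forall t, t \in `[0%R, T]%classic -> derive1 F t = h t}.
Proof.
move=> T0 Lh Fh; have acF := primitive_ac Lh Fh.
have aeF := primitive_derive1 (L2_integrable Lh) Fh.
have mF := ac_measurable_derive1 T0 acF.
have aeF' : {ae leb, forall t, t \in `[0%R, T]%classic -> derive1 F t = h t}.
  have ae1 a : {ae leb, forall t : R, t != a}.
    exists [set a]; split => //; first exact: lebesgue_measure_set1.
    by move=> t /= /negP; rewrite negbK => /eqP.
  have ae0T := @filterI _ _ (ae_filter_ringOfSetsType leb) _ _ (ae1 0) (ae1 T).
  apply: (@filterS2 _ _ (ae_filter_ringOfSetsType leb) _ _ _ _ aeF ae0T) => t Ft [t0 tT]; rewrite inE/= in_itv/= => /andP[t0' tT'].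
  by apply: (Ft _).2; rewrite in_itv/= !lt_neqAle t0' tT' eq_sym t0 tT.
split=> //; split => //.
- by rewrite Fh ?in_itv/= ?lexx ?ltW// set_itv1 Rintegral_set1.
- by apply: (@filterS _ _ (ae_filter_ringOfSetsType leb) _ _ _ aeF) => t /[apply] -[].
split=> //; have [mh h2] := Lh.
have -> : (\int[leb]_(t in `[0%R, T]) (derive1 F t ^+ 2)%:E =
    \int[leb]_(t in `[0%R, T]) (h t ^+ 2)%:E)%E.
  apply: ae_eq_integral => //.
  - by apply/measurable_EFinP; exact: measurable_funX.
  - by apply/measurable_EFinP; exact: measurable_funX.
  - apply: (@filterS _ _ (ae_filter_ringOfSetsType leb) _ _ _ aeF') => t Ft tT.
    by rewrite Ft// inE.
by rewrite N2_integral// ltry.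
Qed.

End measurable_derivative.

(** * Volterra operators *)

Section continuity_on_segments.
Variable R : realType.
Implicit Types (T M d e t : R) (f phi : R -> R).

(** Cousin's lemma applied to the existence of a common [d] on a subinterval. *)
Lemma heine f a b : a <= b -> continuous f -> forall e, 0 < e ->
  exists2 d : R, 0 < d & forall s t, a <= s <= b -> a <= t <= b -> `|s - t| < d ->
    `|f s - f t| < e.
Proof.
move=> ab cf e e0.
have e2 : 0 < e / 2 by rewrite divr_gt0.
have loc c : exists2 d : R, 0 < d & forall s, `|s - c| < d -> `|f s - f c| < e / 2.
  have /cvgrPdist_lt/(_ _ e2)/nbhs_ballP[d /= d0 dP] := cf c.
  by exists d => // s sc; rewrite distrC; apply: dP; rewrite /ball/= distrC.
pose P l r := exists2 d : R, 0 < d & forall s t, l <= s <= r -> l <= t <= r ->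
  `|s - t| < d -> `|f s - f t| < e.
apply: (@cousin _ P) => // [l c r _ lc cr _ [d1 d10 P1] [d2 d20 P2]|x _].
  (* Continuity at the cut point handles pairs lying on opposite sides of it. *)
  have [d3 d30 P3] := loc c.
  exists (Num.min d1 (Num.min d2 d3)); first by rewrite !lt_min d10 d20.
  move=> s t; wlog st : s t / t <= s => [hw sr tr|].
    have [ts|/ltW ts] := leP t s; first exact: hw.
    by rewrite distrC => std; rewrite distrC; apply: hw.
  move=> /andP[ls sr] /andP[lt tr]; rewrite !lt_min => /and3P[h1 h2 h3].
  have [sc|cs] := leP s c; first by apply: P1 => //; apply/andP; split => //; lra.
  have [ct|tc] := leP c t; first by apply: P2 => //; apply/andP; split => //; lra.
  move: h3; rewrite ger0_norm ?subr_ge0// => h3.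
  have p1 : `|s - c| < d3 by rewrite ger0_norm; lra.
  have p2 : `|t - c| < d3 by rewrite ler0_norm; lra.
  have := P3 _ p1; have := P3 _ p2; have := ler_normB (f s - f c) (f t - f c).
  by rewrite opprB addrA subrK; lra.
(* All of [[l, r]] is within [d] of [x], so any positive number, here 1, serves as the common
   distance. *)
have [d d0 dP] := loc x; exists d => // l r _ lx xr _ xl rx; exists 1 => // s t.
move=> /andP[ls sr] /andP[lt tr] _.
have p1 : `|s - x| < d by rewrite ltr_norml; apply/andP; split; lra.
have p2 : `|t - x| < d by rewrite ltr_norml; apply/andP; split; lra.
have := dP _ p1; have := dP _ p2; have := ler_normB (f s - f x) (f t - f x).
by rewrite opprB addrA subrK; lra.
Qed.

Lemma heine_ball f M : 0 <= M -> continuous f -> forall e, 0 < e ->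
  exists2 d : R, 0 < d & forall s t, `|s| <= M -> `|t| <= M -> `|s - t| < d ->
    `|f s - f t| < e.
Proof.
move=> M0 cf e e0; have [|d d0 dP] := @heine f (- M) M _ cf e e0; first by lra.
by exists d => // s t sM tM; apply: dP; rewrite -ler_norml.
Qed.

Lemma bounded_ball f M : 0 <= M -> continuous f ->
  exists2 C : R, 0 < C & forall t, `|t| <= M -> `|f t| <= C.
Proof.
move=> M0 cf; have cf' : {within `[- M, M], continuous (fun x => `|f x|)}.
  apply: continuous_subspaceT => x; apply: cvg_norm; exact: cf.
have [|c _ cP] := EVT_max _ cf'; first by lra.
exists (`|f c| + 1); first by have := normr_ge0 (f c); lra.
move=> t tM; have := cP t; rewrite in_itv/= -ler_norml => /(_ tM) /=; lra.
Qed.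

Lemma pos_ball f M : 0 <= M -> continuous f -> (forall t, 0 < f t) ->
  exists2 C : R, 0 < C & forall t, `|t| <= M -> C <= f t.
Proof.
move=> M0 cf f0; have cf' : {within `[- M, M], continuous f}.
  by apply: continuous_subspaceT => x; exact: cf.
have [|c _ cP] := EVT_min _ cf'; first by lra.
by exists (f c) => // t tM; apply: cP; rewrite in_itv/= -ler_norml.
Qed.

Definition ucont T phi := forall e, 0 < e -> exists2 d : R, 0 < d &
  forall s t, s \in `[0, T] -> t \in `[0, T] -> `|s - t| < d -> `|phi s - phi t| <= e.

Lemma ucont_clamp T phi : 0 < T -> ucont T phi -> continuous (phi \o clamp T).
Proof.
move=> T0 up t; apply/cvgrPdist_le => e e0.
have [d d0 dP] := up e e0; apply/nbhs_ballP; exists d => // s; rewrite /ball/= => ts.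
by apply: dP; rewrite ?clamp_itv//; apply: le_lt_trans ts; exact: clamp_lip.
Qed.

(** Nothing is known of [phi] outside [[0, T]]; precomposing with [clamp T] replaces it by a
    function continuous on the line. *)
Lemma ucont_measurable T phi (tau : R -> R) : 0 < T -> ucont T phi ->
  measurable_fun setT tau -> (forall t, t \in `[0, T] -> tau t \in `[0, T]) ->
  measurable_fun `[0, T] (fun t => phi (tau t)).
Proof.
move=> T0 up mtau tauT.
have mc := continuous_measurable_fun (ucont_clamp T0 up).
apply: (eq_measurable_fun ((phi \o clamp T) \o tau)).
  by move=> t; rewrite inE => tT /=; rewrite clamp_id// tauT.
by apply: (@measurable_funS _ _ _ _ setT) => //; exact: measurableT_comp.
Qed.

Lemma measurable_grid T n : 0 < T -> measurable_fun setT (grid T n).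
Proof.
move=> T0; apply: nondecreasing_measurable => // s t st; rewrite /grid.
apply: ler_wpM2r; first by rewrite divr_ge0// ltW.
rewrite ler_int; apply: le_floor; rewrite ler_wpM2r ?invr_ge0 ?(ltW T0)//.
exact: ler_wpM2l.
Qed.

Lemma grid_bounds T n t : 0 < T -> (0 < n)%N -> 0 <= t ->
  [/\ 0 <= grid T n t, grid T n t <= t & t - grid T n t < T / n%:R].
Proof.
move=> T0 n0 t0; rewrite /grid; set q := n%:R * t / T.
have q0 : 0 <= q by rewrite divr_ge0 ?mulr_ge0// ltW.
have nR : 0 < n%:R :> R by rewrite ltr0n.
have Tn : 0 < T / n%:R by rewrite divr_gt0.
have qt : q * (T / n%:R) = t by rewrite /q; field; rewrite !gt_eqF.
have fl : (Num.floor q)%:~R <= q by exact: floor_le_tmp.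
have fu : q < (Num.floor q)%:~R + 1 by rewrite -intrD1 floorD1_gt.
split.
- by rewrite mulr_ge0 ?(ltW Tn)// ler0z floor_ge0.
- by rewrite -[leRHS]qt ler_pM2r.
- by rewrite -[X in X - _]qt -mulrBl -[ltRHS]mul1r ltr_pM2r//; lra.
Qed.

End continuity_on_segments.

(** * The Volterra integral operator on L2 *)

Section volterra_operator.
Variables (R : realType) (T : R) (K : R -> R -> R).
Local Notation leb := (@lebesgue_measure R).
Hypothesis T0 : 0 < T.
Hypotheses (KV : volterra_kernel T K) (KC : kernel_causal T K)
  (KH : kernel_holder T K).
Implicit Types (g : R -> R) (e d t : R).
Local Notation L2T := (L2 leb `[0, T]).
Local Notation N2T := (N2 leb `[0, T]).

(** Compared with [hat], it acts on the derivative itself and integrates over a domain independent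
    of [t], so that L2 estimates apply directly. *)
Definition volterra g t := \int[leb]_(s in `[0, T]) (K t s * g s).

Lemma kernel_L2 : exists2 C : R, 0 < C & forall t, t \in `[0, T] ->
  L2T (K t) /\ N2T (K t) <= C.
Proof.
have [mK _ supK] := KV.
set S := ereal_sup _ in supK.
have leS t : t \in `[0, T] -> (\int[leb]_(s in `[0%R, T]) ((K t s) ^+ 2)%:E <= S)%E.
  by move=> tT; apply: ereal_sup_ubound; exists t.
have S0 : (0 <= S)%E.
  apply: le_trans (leS 0 _); last by rewrite in_itv/= lexx ltW.
  by apply: integral_ge0 => s _; rewrite lee_fin sqr_ge0.
have Sfin : S \is a fin_num by rewrite ge0_fin_numE.
exists (fine S + 1); first by have := fine_ge0 S0; lra.
move=> t tT; have mKt : measurable_fun `[0, T] (K t).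
  apply: (@measurable_comp _ _ _ _ _ _ (`[0, T] `*` `[0, T]) (fun p : R * R => K p.1 p.2) _ (fun s => (t, s))) => //.
  - exact: measurableX.
  - by move=> _ [s sT <-].
  - by apply: (@measurable_funS _ _ _ _ setT) => //; exact: pair1_measurable.
have LK : L2T (K t) by apply: L2_lty => //; exact: le_lt_trans (leS _ tT) supK.
split=> //; apply: (@le_trans _ _ (fine S)); last by rewrite lerDl.
rewrite -lee_fin (fineK Sfin); apply: le_trans _ (leS t tT).
by rewrite le_eqVlt; apply/orP; left; apply/eqP/esym; exact: N2_integral.
Qed.

Lemma kernel_continuity e : 0 < e -> exists2 d : R, 0 < d &
  forall s t, s \in `[0, T] -> t \in `[0, T] -> `|s - t| < d ->
    N2T (fun r => K s r - K t r) <= e.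
Proof.
move=> e0; have [c [a [c0 a0 ca]]] := KH; have [C _ KL] := kernel_L2.
pose z := (e / c) `^ a^-1.
have ec : 0 < e / c by rewrite divr_gt0.
have z0 : 0 < z by rewrite powR_gt0.
pose d := Num.min T z.
have d0 : 0 < d by rewrite lt_min T0.
exists d => // s t sT tT st.
have dT : d \in `[0, T] by rewrite in_itv/= (ltW d0) ge_min lexx.
have := ca d dT; set S := ereal_sup _ => Sle.
have Lst : L2T (fun r => K s r - K t r).
  by apply: L2B => //; [case: (KL s sT)|case: (KL t tT)].
rewrite -lee_fin -N2_integral//.
have -> : (\int[leb]_(x in `[0%R, T]) ((K s x - K t x) ^+ 2)%:E = kernel_dist2 T K s t)%E.
  by apply: eq_integral => x _; rewrite real_normK// num_real.
apply: (@le_trans _ _ S).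
  by apply: ereal_sup_ubound; exists (s, t) => //; split => //=; exact: ltW.
apply: (le_trans Sle); rewrite lee_fin mulrC -ler_pdivlMr//.
apply: (@le_trans _ _ (z `^ a)).
  by apply: ge0_ler_powR; rewrite ?nnegrE ?(ltW a0) ?(ltW d0) ?(ltW z0)// ge_min lexx orbT.
by rewrite /z -powRrM mulVf ?gt_eqF// powRr1// ltW.
Qed.

(** By causality the kernel vanishes beyond [t]. *)
Lemma hat_volterra (f : R -> R) t : t \in `[0, T] -> hat K f t = volterra (derive1 f) t.
Proof.
rewrite in_itv/= => /andP[t0 tT]; rewrite /hat /volterra.
have -> : (`[0, t]%classic : set R) = `[0, T] `&` `[0, t].
  apply/seteqP; split => s /=; rewrite !in_itv/=; last by case.
  by move=> /andP[-> st]; rewrite st (le_trans st tT).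
rewrite Rintegral_mkcondr; apply: eq_Rintegral => s; rewrite inE/= in_itv/= => /andP[s0 sT].
rewrite patchE; case: ifPn => //; rewrite notin_setE /= in_itv/= s0 /= => /negP.
by rewrite -ltNge => ts; rewrite KC.2 ?mul0r.
Qed.

Lemma volterra_linear a b g1 g2 t : t \in `[0, T] -> L2T g1 -> L2T g2 ->
  volterra (fun s => a * g1 s + b * g2 s) t = a * volterra g1 t + b * volterra g2 t.
Proof.
move=> tT L1 L2'; have [C _ KL] := kernel_L2; have [LK _] := KL t tT.
have i1 : leb.-integrable `[0, T] (EFin \o (fun s => K t s * g1 s)).
  exact: L2_mul_integrable.
have i2 : leb.-integrable `[0, T] (EFin \o (fun s => K t s * g2 s)).
  exact: L2_mul_integrable.
have j1 : leb.-integrable `[0, T] (EFin \o (fun s => a * (K t s * g1 s))).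
  exact: integrableRZ.
have j2 : leb.-integrable `[0, T] (EFin \o (fun s => b * (K t s * g2 s))).
  exact: integrableRZ.
rewrite /volterra -!RintegralZl// -RintegralD//.
by apply: eq_Rintegral => s _; ring.
Qed.

Lemma volterra_bound : exists2 C : R, 0 < C & forall g t, t \in `[0, T] -> L2T g ->
  (volterra g t) ^+ 2 <= C * N2T g.
Proof.
have [C C0 KL] := kernel_L2; exists C => // g t tT Lg; have [LK NK] := KL t tT.
apply: le_trans (cauchy_schwarz _ LK Lg) _ => //.
by rewrite ler_wpM2r// N2_ge0.
Qed.

(** Cauchy-Schwarz against [K s - K t], whose norm is small uniformly in [s] and [t]; hence one [d]
    for the whole ball of L2. *)
Lemma volterra_equicontinuous B e : 0 <= B -> 0 < e -> exists2 d : R, 0 < d &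
  forall g s t, L2T g -> N2T g <= B -> s \in `[0, T] -> t \in `[0, T] ->
    `|s - t| < d -> `|volterra g s - volterra g t| <= e.
Proof.
move=> B0 e0; have e1 : 0 < e ^+ 2 / (B + 1) by rewrite divr_gt0 ?exprn_gt0//; lra.
have [d d0 dP] := kernel_continuity e1; have [C _ KL] := kernel_L2.
exists d => // g s t Lg gB sT tT st.
have [LKs _] := KL s sT; have [LKt _] := KL t tT.
have i1 : leb.-integrable `[0, T] (EFin \o (fun r => K s r * g r)).
  exact: L2_mul_integrable.
have i2 : leb.-integrable `[0, T] (EFin \o (fun r => K t r * g r)).
  exact: L2_mul_integrable.
have -> : volterra g s - volterra g t = \int[leb]_(r in `[0, T]) ((K s r - K t r) * g r).
  rewrite /volterra -RintegralB//.
  by apply: eq_Rintegral => r _; rewrite mulrBl.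
rewrite -ler_sqr ?nnegrE ?(ltW e0)// real_normK ?num_real//.
have LD : L2T (fun r => K s r - K t r) by exact: L2B.
apply: le_trans (cauchy_schwarz _ LD Lg) _ => //.
have NK := dP s t sT tT st.
apply: (@le_trans _ _ (e ^+ 2 / (B + 1) * (B + 1))).
  apply: ler_pM => //; rewrite ?N2_ge0//; lra.
by rewrite divfK// gt_eqF//; lra.
Qed.

End volterra_operator.

(** * The cost functional *)

Section cost_functional.
Variables (R : realType) (T : R) (K : R -> R -> R) (mu sigma : R -> R) (rho : R).
Local Notation leb := (@lebesgue_measure R).
Hypothesis T0 : 0 < T.
Hypotheses (KV : volterra_kernel T K) (KC : kernel_causal T K)
  (KH : kernel_holder T K).
Hypotheses (rho_gtN1 : -1 < rho) (rho_lt1 : rho < 1).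
Hypotheses (cmu : continuous mu) (csigma : continuous sigma)
  (sigma_gt0 : forall x, 0 < sigma x).
Implicit Types (f x y g : R -> R) (e d t : R).
Local Notation L2T := (L2 leb `[0, T]).
Local Notation N2T := (N2 leb `[0, T]).
Local Notation rb := (rho_bar rho).

Lemma rho_bar_gt0 : 0 < rb.
Proof. by rewrite sqrtr_gt0; move: rho_gtN1 rho_lt1; nra. Qed.

(** The integrand of the second cost term before squaring. Solving its definition for the derivative
    of [y] makes it a second control, next to [derive1 f]. *)
Definition residual (tau : R -> R) y f t : R :=
  (derive1 y t - mu (hat K f t) - rho * sigma (hat K f (tau t)) * derive1 f t)
  / (rb * sigma (hat K f t)).

Lemma residualK tau y f t : derive1 y t = mu (hat K f t)
  + rho * sigma (hat K f (tau t)) * derive1 f t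
  + rb * sigma (hat K f t) * residual tau y f t.
Proof.
rewrite /residual; have := rho_bar_gt0; have := sigma_gt0 (hat K f t) => s0 r0.
by field; rewrite !gt_eqF.
Qed.

Lemma hat_ucont f : H01 T f -> ucont T (hat K f).
Proof.
move=> Hf e e0; have Lf := H01_L2 Hf.
have [d d0 dP] := volterra_equicontinuous T0 KV KH (N2_ge0 leb `[0, T] (derive1 f)) e0.
by exists d => // s t sT tT st; rewrite !(hat_volterra KC)//; exact: dP.
Qed.

Lemma hat_bounded B : exists2 M : R, 0 < M & forall f t, H01 T f ->
  N2T (derive1 f) <= B -> t \in `[0, T] -> `|hat K f t| <= M.
Proof.
have [C C0 CP] := volterra_bound T0 KV.
(* A number whose square is at most [C * |B|] has absolute value at most [C * |B| + 1]. *)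
exists (C * `|B| + 1); first by have := normr_ge0 B; nra.
move=> f t Hf fB tT; rewrite (hat_volterra KC)//.
have := CP _ t tT (H01_L2 Hf); set v := volterra _ _ _ _ => vC.
have : v ^+ 2 <= C * `|B| by apply: le_trans vC _; rewrite ler_pM2l// (le_trans fB)// ler_norm.
by rewrite ler_norml; have := normr_ge0 B => *; apply/andP; split; nra.
Qed.

(** The path [hat K f] stays in a compact interval, where [mu] and [sigma] are bounded and [sigma]
    is bounded away from zero. *)
Lemma residual_L2 tau y f : measurable_fun setT tau ->
  (forall t, t \in `[0, T] -> tau t \in `[0, T]) -> H01 T y -> H01 T f ->
  L2T (residual tau y f).
Proof.
move=> mtau tauT Hy Hf.
have [M M0 MP] := hat_bounded (N2T (derive1 f)).
have fM t : t \in `[0, T] -> `|hat K f t| <= M by move=> tT; exact: MP.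
have uf := hat_ucont Hf.
have idT t : t \in `[0, T] -> id t \in `[0, T] by [].
have mf : measurable_fun `[0, T] (hat K f) by exact: (@ucont_measurable _ T _ id T0 uf).
have mft : measurable_fun `[0, T] (fun t => hat K f (tau t)) by exact: ucont_measurable.
have mcomp (G h : R -> R) : continuous G -> measurable_fun `[0, T] h ->
    measurable_fun `[0, T] (fun t => G (h t)).
  by move=> cG mh; apply: measurableT_comp => //; exact: continuous_measurable_fun.
have [Cm Cm0 CmP] := bounded_ball (ltW M0) cmu.
have [Cs Cs0 CsP] := bounded_ball (ltW M0) csigma.
have [c c0 cP] := pos_ball (ltW M0) csigma sigma_gt0.
have r0 := rho_bar_gt0.
have L1 : L2T (fun t => mu (hat K f t)).
  apply: (@L2_bounded _ _ _ leb `[0, T] _ _ Cm) => //; first exact: itv_lty.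
    exact: mcomp.
  by move=> t tT; apply: CmP; exact: fM.
have L2' : L2T (fun t => (rho * sigma (hat K f (tau t))) * derive1 f t).
  apply: (@L2_bounded_mul _ _ _ leb `[0, T] _ _ _ (`|rho| * Cs)) => //.
  - by apply: measurable_funM => //; exact: mcomp.
  - by move=> t tT; rewrite normrM ler_wpM2l//; apply: CsP; apply: fM; exact: tauT.
  - exact: H01_L2.
have LN : L2T (fun t => derive1 y t - mu (hat K f t) - rho * sigma (hat K f (tau t)) * derive1 f t).
  by apply: L2B => //; apply: L2B => //; exact: H01_L2.
apply: (@L2_ext _ _ _ leb `[0, T] _ (fun t => (rb * sigma (hat K f t))^-1 *
    (derive1 y t - mu (hat K f t) - rho * sigma (hat K f (tau t)) * derive1 f t))) => //.
  by move=> t _; rewrite mulrC.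
apply: (@L2_bounded_mul _ _ _ leb `[0, T] _ _ _ (rb * c)^-1) => //.
  apply: (mcomp (fun z => (rb * sigma z)^-1)) => // z.
  apply: cvgV; first by rewrite gt_eqF// mulr_gt0.
  by apply: cvgMr; exact: csigma.
move=> t tT; have s0 := sigma_gt0 (hat K f t).
rewrite gtr0_norm ?invr_gt0 ?mulr_gt0// lef_pV2 ?posrE ?mulr_gt0// ler_pM2l//.
by apply: cP; exact: fM.
Qed.

Lemma costE tau y f : measurable_fun setT tau ->
  (forall t, t \in `[0, T] -> tau t \in `[0, T]) -> H01 T y -> H01 T f ->
  cost T K mu sigma rho tau y f =
  (2^-1 * N2T (derive1 f) + 2^-1 * N2T (residual tau y f))%:E.
Proof.
move=> mtau tauT Hy Hf; rewrite /cost /H01_norm2.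
have -> : (\int[leb]_(t in `[0%R, T]) (derive1 f t ^+ 2)%:E = (N2T (derive1 f))%:E)%E.
  by apply: N2_integral => //; exact: H01_L2.
have -> : (\int[leb]_(t in `[0%R, T])
     (((derive1 y t - mu (hat K f t) - rho * sigma (hat K f (tau t)) * derive1 f t)
       / (rb * sigma (hat K f t))) ^+ 2)%:E = (N2T (residual tau y f))%:E)%E.
  by apply: (@N2_integral _ _ _ leb `[0, T]) => //; exact: residual_L2.
by rewrite EFinD !EFinM.
Qed.

Lemma grid_itv n t : (0 < n)%N -> t \in `[0, T] -> grid T n t \in `[0, T].
Proof.
move=> n0; rewrite in_itv/= => /andP[t0 tT]; have [g0 gt _] := grid_bounds T0 n0 t0.
by rewrite in_itv/= g0 (le_trans gt).
Qed.

Lemma grid_close d : 0 < d -> exists N, forall n t, (N <= n)%N -> t \in `[0, T] ->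
  (0 < n)%N /\ `|t - grid T n t| < d.
Proof.
move=> d0; have Td : 0 < d / T by rewrite divr_gt0.
have /= [N _ NP] := near_infty_natSinv_lt (PosNum Td).
exists N.+1 => n t Nn; rewrite in_itv/= => /andP[t0 tT].
have n0 : (0 < n)%N by exact: leq_trans Nn.
split=> //; have [g0 gt tg] := grid_bounds T0 n0 t0.
rewrite ger0_norm ?subr_ge0//; apply: (lt_le_trans tg).
have : N.+1%:R^-1 < d / T by apply: NP => /=.
rewrite ltr_pdivlMr// mulrC => /ltW; apply: le_trans.
by rewrite ler_pM2l// lef_pV2 ?posrE ?ltr0n// ler_nat.
Qed.

(** The cross term is absorbed by [2 * |b * (U * G)| <= q * (U ^+ 2 + G ^+ 2)], which keeps the
    coefficient of [U ^+ 2] close to 1. *)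
Lemma sqr_perturb (q b U G : R) : q <= 1 -> `|b| <= q ->
  (U + b * G) ^+ 2 <= (1 + q) * U ^+ 2 + 2 * q * G ^+ 2.
Proof.
move=> q1; rewrite ler_norml => /andP[b1 b2].
have b3 : b ^+ 2 <= q by nra.
have h1 : b ^+ 2 * G ^+ 2 <= q * G ^+ 2 by rewrite ler_wpM2r ?sqr_ge0.
have h2 : 2 * b * (U * G) <= q * (U ^+ 2 + G ^+ 2).
  have h3 : 0 <= (q - b) * (U + G) ^+ 2 by rewrite mulr_ge0 ?sqr_ge0//; lra.
  have h4 : 0 <= (q + b) * (U - G) ^+ 2 by rewrite mulr_ge0 ?sqr_ge0//; lra.
  by lra.
have -> : (U + b * G) ^+ 2 = U ^+ 2 + 2 * b * (U * G) + b ^+ 2 * G ^+ 2 by ring.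
by lra.
Qed.

(** Only the correlation term sees the grid, so the residual changes by a multiple [b] of
    [derive1 f], and [b] is uniformly small on fine grids by uniform continuity of [sigma] and
    [hat K f]. *)
Lemma cost_grid_le x f e : H01 T x -> H01 T f -> 0 < e -> exists N, forall n,
  (N <= n)%N -> (cost T K mu sigma rho (grid T n) x f <= cost T K mu sigma rho id x f + e%:E)%E.
Proof.
move=> Hx Hf e0; have Lf := H01_L2 Hf.
have Lu : L2T (residual id x f) by exact: residual_L2.
pose S := N2T (residual id x f) + 2 * N2T (derive1 f).
have S0 : 0 <= S by rewrite addr_ge0 ?mulr_ge0 ?N2_ge0.
(* The squared norm of the residual grows by at most [q * S]; [q * S <= 2 * e] suffices because the
   cost carries the factor one half. *)
pose q : R := Num.min 1 (2 * e / (S + 1)).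
have q0 : 0 < q by rewrite lt_min ltr01 divr_gt0 ?mulr_gt0//; lra.
have q1 : q <= 1 by rewrite ge_min lexx.
have qS : q * S <= 2 * e.
  have h : q <= 2 * e / (S + 1) by rewrite ge_min lexx orbT.
  have : q * (S + 1) <= 2 * e by rewrite -ler_pdivlMr//; lra.
  by nra.
have [M M0 MP] := hat_bounded (N2T (derive1 f)).
have fM t : t \in `[0, T] -> `|hat K f t| <= M by move=> tT; exact: MP.
have [c c0 cP] := pos_ball (ltW M0) csigma sigma_gt0.
have r0 := rho_bar_gt0.
have qc : 0 < q * (rb * c) by rewrite !mulr_gt0.
have [d1 d10 d1P] := heine_ball (ltW M0) csigma qc.
have [d2 d20 d2P] := hat_ucont Hf (divr_gt0 d10 (ltr0n _ 2)).
have [N NP] := grid_close d20.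
exists N => n Nn.
have n0 : (0 < n)%N.
  by have [] := NP n 0 Nn _; rewrite // in_itv/= lexx ltW.
have gT t : t \in `[0, T] -> grid T n t \in `[0, T] by exact: grid_itv.
have mg := measurable_grid n T0.
have Lm : L2T (residual (grid T n) x f) by exact: residual_L2.
rewrite !costE// -EFinD lee_fin -addrA lerD2l.
suff : N2T (residual (grid T n) x f) <= N2T (residual id x f) + q * S by lra.
have key t : t \in `[0, T] -> residual (grid T n) x f t ^+ 2 <=
   (1 + q) * residual id x f t ^+ 2 + 2 * q * derive1 f t ^+ 2.
  move=> tT; pose b := rho * (sigma (hat K f t) - sigma (hat K f (grid T n t))) / (rb * sigma (hat K f t)).
  have s0 := sigma_gt0 (hat K f t).
  have -> : residual (grid T n) x f t = residual id x f t + b * derive1 f t.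
    by rewrite /residual /b; field; rewrite !gt_eqF.
  have bq : `|b| <= q.
    rewrite /b normrM normfV (gtr0_norm (mulr_gt0 r0 s0)) ler_pdivrMr ?mulr_gt0//.
    rewrite normrM; apply: (@le_trans _ _ (1 * (q * (rb * c)))).
      apply: ler_pM => //; first by rewrite ler_norml !ltW.
      apply: ltW; apply: d1P; rewrite ?fM ?gT//.
      have [_ tg] := NP n t Nn tT; apply: le_lt_trans (d2P _ _ tT (gT _ tT) tg) _.
      by rewrite ltr_pdivrMr// ltr_pMr// ltr1n.
    by rewrite mul1r ler_pM2l// ler_pM2l//; apply: cP; exact: fM.
  exact: sqr_perturb.
have [_ i1] := Lu; have [_ i2] := Lf; have [_ i3] := Lm.
have j1 : leb.-integrable `[0, T] (EFin \o (fun t => (1 + q) * residual id x f t ^+ 2)).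
  exact: integrableRZ.
have j2 : leb.-integrable `[0, T] (EFin \o (fun t => (2 * q) * derive1 f t ^+ 2)).
  exact: integrableRZ.
apply: (@le_trans _ _ (\int[leb]_(t in `[0, T])
   ((1 + q) * residual id x f t ^+ 2 + 2 * q * derive1 f t ^+ 2))).
  by apply: le_Rintegral => //; exact: integrableRD.
have -> : \int[leb]_(t in `[0, T])
   ((1 + q) * residual id x f t ^+ 2 + 2 * q * derive1 f t ^+ 2) =
   (1 + q) * N2T (residual id x f) + 2 * q * N2T (derive1 f).
  by rewrite RintegralD// !RintegralZl.
by rewrite le_eqVlt; apply/orP; left; apply/eqP; rewrite /S; ring.
Qed.

End cost_functional.

(** * Inferior limits of sequences of extended reals *)

Section limits_inferior.
Variable R : realType.
Implicit Types (u : nat -> \bar R) (c : \bar R).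

Lemma limn_einf_le u c : (exists N, forall n, (N <= n)%N -> (u n <= c)%E) ->
  (limn_einf u <= c)%E.
Proof.
move=> [N uc]; rewrite limn_einf_lim; apply: lime_le; first exact: is_cvg_einfs.
apply: nearW => n; apply: (@le_trans _ _ (u (maxn N n))); last by apply: uc; exact: leq_maxl.
by apply: ereal_inf_lbound; exists (maxn N n) => //=; exact: leq_maxr.
Qed.

Lemma limn_einf_lt u c : (limn_einf u < c)%E ->
  forall N, exists2 n, (N <= n)%N & (u n < c)%E.
Proof.
move=> uc N; apply: contrapT => nu; move: uc; rewrite ltNge => /negP; apply.
rewrite limn_einf_lim; apply: lime_ge; first exact: is_cvg_einfs.
exists N => // n /= Nn; apply: le_ereal_inf_tmp => _ [k /= nk <-].
rewrite leNgt; apply/negP => ukc; apply: nu; exists k => //; exact: leq_trans nk.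
Qed.

End limits_inferior.

(** * Compactness *)

Section weak_limits.
Variables (R : realType) (T : R).
Local Notation leb := (@lebesgue_measure R).
Implicit Types (f g h p q u : R -> R) (c e t M : R).
Local Notation L2T := (L2 leb `[0, T]).
Local Notation N2T := (N2 leb `[0, T]).

Lemma integrable_subitv p t : leb.-integrable `[0, T] (EFin \o p) -> t \in `[0, T] ->
  leb.-integrable `[0, t] (EFin \o p).
Proof.
move=> ip; rewrite in_itv/= => /andP[t0 tT].
by apply: integrableS ip => //; apply: subset_itvl; rewrite bnd_simp.
Qed.

Lemma integrable_itv_cst c : leb.-integrable `[0, T] (EFin \o (fun=> c)).
Proof.
apply: measurable_bounded_integrable => //; first exact: itv_lty.
by exists `|c|; split; [rewrite num_real|move=> M CM x _; rewrite ltW].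
Qed.

Lemma Rintegral_itv_cst c : 0 <= T -> \int[leb]_(s in `[0, T]) c = c * T.
Proof.
move=> T0; rewrite Rintegral_cst//; congr (_ * _).
have := @lebesgue_measure_itv R `[0, T]; rewrite /= => ->.
by rewrite lte_fin; case: ltP => // ?; rewrite /=; lra.
Qed.

(** The bound does not depend on [t]: the integral of the majorant, which is nonnegative, is
    enlarged from [[0, t]] to [[0, T]]. *)
Lemma Rintegral_itv_dist p q g u c0 c1 c2 t : 0 <= T ->
  leb.-integrable `[0, T] (EFin \o p) -> leb.-integrable `[0, T] (EFin \o q) ->
  L2T g -> L2T u ->
  (forall s, s \in `[0, T] -> `|p s - q s| <= c0 + c1 * g s ^+ 2 + c2 * u s ^+ 2) ->
  t \in `[0, T] ->
  `|\int[leb]_(s in `[0, t]) p s - \int[leb]_(s in `[0, t]) q s| <=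
    c0 * T + c1 * N2T g + c2 * N2T u.
Proof.
move=> T0 ip iq [mg g2] [mu u2] pq tT.
have i0 := integrable_itv_cst c0.
have i1 : leb.-integrable `[0, T] (EFin \o (fun s => c1 * g s ^+ 2)) by exact: integrableRZ.
have i2 : leb.-integrable `[0, T] (EFin \o (fun s => c2 * u s ^+ 2)) by exact: integrableRZ.
have i01 : leb.-integrable `[0, T] (EFin \o (fun s => c0 + c1 * g s ^+ 2)) by exact: integrableRD.
have i3 : leb.-integrable `[0, T] (EFin \o (fun s => c0 + c1 * g s ^+ 2 + c2 * u s ^+ 2)).
  exact: integrableRD.
have ipt := integrable_subitv ip tT; have iqt := integrable_subitv iq tT.
have i3t := integrable_subitv i3 tT.
have iD : leb.-integrable `[0, t] (EFin \o (fun s => p s - q s)) by exact: integrableRB.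
rewrite -RintegralB//.
apply: le_trans (le_normr_Rintegral _ _) _ => //.
have sub s : (`[0, t]%classic : set R) s -> s \in `[0, T].
  move: tT; rewrite /= !in_itv/= => /andP[_ tT] /andP[-> st].
  exact: le_trans tT.
apply: (@le_trans _ _ (\int[leb]_(s in `[0, t]) (c0 + c1 * g s ^+ 2 + c2 * u s ^+ 2))).
  apply: le_Rintegral => //; first exact: integrable_norm.
  by move=> s /sub; exact: pq.
have -> : c0 * T + c1 * N2T g + c2 * N2T u =
    \int[leb]_(s in `[0, T]) (c0 + c1 * g s ^+ 2 + c2 * u s ^+ 2).
  by rewrite !RintegralD// !RintegralZl// Rintegral_itv_cst.
rewrite -lee_fin /Rintegral !fineK; [|exact: integrable_fin_num..].
apply: ge0_subset_integral => //.
- by case/integrableP : i3.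
- move=> s sT; rewrite lee_fin; apply: le_trans (pq s sT) => //.
Qed.

(** Young's inequality for [g = p - (p - g)]. It carries norm bounds over to strong limits. *)
Lemma N2_le_perturb g p e : 0 < e -> L2T g -> L2T p ->
  N2T g <= (1 + e) * N2T p + (1 + e^-1) * N2T (fun s => p s - g s).
Proof.
move=> e0 Lg Lp; have Ld : L2T (fun s => p s - g s) by exact: L2B.
have [_ i1] := Lg; have [_ i2] := Lp; have [_ i3] := Ld.
have j2 : leb.-integrable `[0, T] (EFin \o (fun s => (1 + e) * p s ^+ 2)).
  exact: integrableRZ.
have j3 : leb.-integrable `[0, T] (EFin \o (fun s => (1 + e^-1) * (p s - g s) ^+ 2)).
  exact: integrableRZ.
rewrite /N2 -!RintegralZl// -RintegralD//; apply: le_Rintegral => //.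
  exact: integrableRD.
move=> s _; set a := p s; set b := g s.
have ei : 0 < e^-1 by rewrite invr_gt0.
have := mulr_ge0 (ltW ei) (sqr_ge0 (e * a + (a - b))).
have -> : e^-1 * (e * a + (a - b)) ^+ 2 = e * a ^+ 2 + 2 * (a * (a - b)) + e^-1 * (a - b) ^+ 2.
  by field; rewrite gt_eqF.
by nra.
Qed.

Lemma ae_eq_N2 g u : measurable_fun `[0, T] g -> measurable_fun `[0, T] u ->
  {ae leb, forall t, t \in `[0%R, T]%classic -> g t = u t} -> N2T g = N2T u.
Proof.
move=> mg mu gu; rewrite /N2 /Rintegral; congr fine; apply: ae_eq_integral => //.
- by apply/measurable_EFinP; exact: measurable_funX.
- by apply/measurable_EFinP; exact: measurable_funX.
- apply: (@filterS _ _ (ae_filter_ringOfSetsType leb) _ _ _ gu) => t gut tT.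
  by rewrite gut// inE.
Qed.

Lemma filter_all (I : Type) (F : set_system I) (P : nat -> set I) n : Filter F ->
  (forall i, F (P i)) -> F [set k | forall i, (i < n)%N -> P i k].
Proof.
move=> FF FP; elim: n => [|n IH]; first by apply: filterS filterT => k _ i.
apply: filterS (filterI IH (FP n)) => k [h1 h2] i.
by rewrite ltnS leq_eqVlt => /predU1P[->//|]; exact: h1.
Qed.

(** Compactness of a segment gives a cluster point, and an ultrafilter, which contains any set or
    its complement, converges to its cluster points. *)
Lemma ultra_limit (I : Type) (F : set_system I) (a : I -> R) M : UltraFilter F ->
  (forall k, `|a k| <= M) ->
  exists2 l : R, `|l| <= M & forall e, 0 < e -> F [set k | `|a k - l| < e].
Proof.
move=> FU aM; have FP : ProperFilter F by exact: ultra_proper.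
have FM : F (a @^-1` `[- M, M]).
  by apply: filterS filterT => k _ /=; rewrite in_itv/= -ler_norml.
have [l [/= lM lcl]] := @segment_compact R (- M) M (a @ F) _ FM.
exists l; first by move: lM; rewrite in_itv/= -ler_norml.
move=> e e0; have [//|Fn] := in_ultra_setVsetC [set k | `|a k - l| < e] FU.
have [v [/= nv lv]] := lcl [set v | ~ (`|v - l| < e)] (ball l e) Fn (nbhsx_ballx l e e0).
by exfalso; apply: nv; rewrite distrC.
Qed.

(* The Arzela-Ascoli argument, an ultrafilter replacing the extraction of a
   subsequence. *)
Lemma ultra_uniform_limit (I : Type) (F : set_system I) (a : I -> R -> R) M : 0 < T ->
  UltraFilter F -> (forall k t, t \in `[0, T] -> `|a k t| <= M) ->
  (forall e, 0 < e -> exists2 d : R, 0 < d & forall k s t, s \in `[0, T] ->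
     t \in `[0, T] -> `|s - t| < d -> `|a k s - a k t| <= e) ->
  exists phi, [/\ ucont T phi, forall t, t \in `[0, T] -> `|phi t| <= M &
    forall e, 0 < e -> F [set k | forall t, t \in `[0, T] -> `|a k t - phi t| <= e]].
Proof.
move=> T0 FU aM aeq; have FP : ProperFilter F by exact: ultra_proper.
have lim t : exists l, t \in `[0, T] -> `|l| <= M /\
    forall e, 0 < e -> F [set k | `|a k t - l| < e].
  have [tT|ntT] := boolP (t \in `[0, T]); last by exists 0.
  have [l lM lF] := @ultra_limit _ F (a ^~ t) M FU (fun k => aM k t tT).
  by exists l.
have [phi phiP] := choice lim.
(* The same [d] serves for [phi] and for all the [a k]. *)
have up e : 0 < e -> exists2 d : R, 0 < d & forall s t, s \in `[0, T] ->
    t \in `[0, T] -> `|s - t| < d ->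
    `|phi s - phi t| <= e /\ forall k, `|a k s - a k t| <= e.
  move=> e0; have [d d0 dP] := aeq e e0; exists d => // s t sT tT st.
  split; last by move=> k; exact: dP.
  apply/ler_addgt0Pr => z z0; have z2 : 0 < z / 2 by rewrite divr_gt0.
  have [_ Fs] := phiP s sT; have [_ Ft] := phiP t tT.
  have [k [/= ks kt]] := filter_ex (filterI (Fs _ z2) (Ft _ z2)).
  have := dP k s t sT tT st; have := ler_normB (a k s - a k t) ((a k s - phi s) - (a k t - phi t)).
  have := ler_normB (a k s - phi s) (a k t - phi t).
  have -> : a k s - a k t - (a k s - phi s - (a k t - phi t)) = phi s - phi t by ring.
  by move: ks kt; set x1 := `|a k s - phi s|; set x2 := `|a k t - phi t|; lra.
exists phi; split.
- by move=> e e0; have [d d0 dP] := up e e0; exists d => // s t sT tT /(dP s t sT tT)[].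
- by move=> t /phiP[].
move=> e e0; have e3 : 0 < e / 3 by rewrite divr_gt0.
have [d d0 dP] := up _ e3.
have [N NP] := grid_close T0 d0.
(* Pointwise convergence is used only at the finitely many grid points, hence simultaneously;
   equicontinuity covers the cells in between. *)
pose P (i : nat) := [set k : I | i%:R * (T / N%:R) \in `[0, T] ->
  `|a k (i%:R * (T / N%:R)) - phi (i%:R * (T / N%:R))| < e / 3].
have FPi i : F (P i).
  rewrite /P; have [iT|niT] := boolP (i%:R * (T / N%:R) \in `[0, T]).
    by apply: filterS ((phiP _ iT).2 _ e3) => k h _.
  by apply: filterS filterT => k _.
apply: filterS (@filter_all _ _ P N.+1 _ FPi) => k kP t tT.
have [N0 tg] := NP N t (leqnn N) tT.
have gT := grid_itv T0 N0 tT.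
have [i iN gi] : exists2 i, (i < N.+1)%N & grid T N t = i%:R * (T / N%:R).
  have NR : 0 < N%:R :> R by rewrite ltr0n.
  have q0 : 0 <= N%:R * t / T.
    by move: tT; rewrite in_itv/= => /andP[t0 _]; rewrite divr_ge0 ?mulr_ge0// ltW.
  exists `|Num.floor (N%:R * t / T)|%N.
    have f0 : 0 <= Num.floor (N%:R * t / T) by rewrite floor_ge0.
    rewrite ltnS -lez_nat gez0_abs// -(@ler_int R) -[X in _ <= X]/(N%:R).
    apply: le_trans (floor_le_tmp _) _.
    rewrite ler_pdivrMr// ler_pM2l//.
    by move: tT; rewrite in_itv/= => /andP[].
  by rewrite /grid natr_absz ger0_norm ?floor_ge0.
have [h1 /(_ k) h2] := dP _ _ tT gT tg.
have := kP i iN; rewrite /P /= -gi => /(_ gT) h3.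
have := ler_normB (a k t - a k (grid T N t)) ((phi t - phi (grid T N t)) - (a k (grid T N t) - phi (grid T N t))).
have := ler_normB (phi t - phi (grid T N t)) (a k (grid T N t) - phi (grid T N t)).
set s := grid T N t in h1 h2 h3 *.
have -> : a k t - a k s - (phi t - phi s - (a k s - phi s)) = a k t - phi t by ring.
lra.
Qed.

End weak_limits.

(** * Controls that reproduce a given pair of paths *)

Section controls.
Variables (R : realType) (T : R) (K : R -> R -> R) (mu sigma : R -> R) (rho : R).
Local Notation leb := (@lebesgue_measure R).
Hypothesis T0 : 0 < T.
Hypotheses (KV : volterra_kernel T K) (KC : kernel_causal T K)
  (KH : kernel_holder T K).
Hypotheses (rho_gtN1 : -1 < rho) (rho_lt1 : rho < 1).
Hypotheses (cmu : continuous mu) (csigma : continuous sigma)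
  (sigma_gt0 : forall x, 0 < sigma x).
Variables (x phi : R -> R) (M B : R).
Hypotheses (M0 : 0 < M) (uphi : ucont T phi)
  (phiM : forall t, t \in `[0, T] -> `|phi t| <= M).
Implicit Types (f y g u : R -> R) (e d t : R).
Local Notation L2T := (L2 leb `[0, T]).
Local Notation N2T := (N2 leb `[0, T]).
Local Notation rb := (rho_bar rho).

(** The right-hand side of [residualK] with [phi] frozen in place of [hat K f], on the grid and off
    it; it is affine in [(g, u)]. *)
Definition velocity g u t : R :=
  mu (phi t) + rho * sigma (phi t) * g t + rb * sigma (phi t) * u t.

(* The controls [(g, u)] that reproduce [phi] and [x] up to [e].  Once [phi] is
   fixed all the constraints are convex, although the map from [g] to the
   velocity of [x] is not linear. *)
Definition near_controls e : set ((R -> R) * (R -> R)) :=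
  [set p | [/\ L2T p.1, L2T p.2, N2T p.1 + N2T p.2 <= B,
    forall t, t \in `[0, T] -> `|volterra T K p.1 t - phi t| <= e &
    forall t, t \in `[0, T] ->
      `|x t - \int[leb]_(s in `[0, t]) velocity p.1 p.2 s| <= e]].

Lemma phi_measurable (G : R -> R) : continuous G ->
  measurable_fun `[0, T] (fun t => G (phi t)).
Proof.
move=> cG; apply: measurableT_comp; first exact: continuous_measurable_fun.
exact: (@ucont_measurable _ T phi id T0 uphi).
Qed.

Lemma sigma_phi_mul_L2 (a : R) g : L2T g -> L2T (fun t => a * sigma (phi t) * g t).
Proof.
move=> Lg; have [C C0 CP] := bounded_ball (ltW M0) csigma.
apply: (@L2_bounded_mul _ _ _ leb `[0, T] _ _ _ (`|a| * C)) => //.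
  by apply: measurable_funM => //; exact: phi_measurable.
by move=> t tT; rewrite normrM ler_wpM2l//; apply: CP; exact: phiM.
Qed.

Lemma mu_phi_L2 : L2T (fun t => mu (phi t)).
Proof.
have [C C0 CP] := bounded_ball (ltW M0) cmu.
apply: (@L2_bounded _ _ _ leb `[0, T] _ _ C) => //; first exact: itv_lty.
  exact: phi_measurable.
by move=> t tT; apply: CP; exact: phiM.
Qed.

Lemma velocity_L2 g u : L2T g -> L2T u -> L2T (velocity g u).
Proof.
move=> Lg Lu; have L1 := mu_phi_L2; have L2' := sigma_phi_mul_L2 rho Lg.
have L3 := sigma_phi_mul_L2 rb Lu.
have L12 : L2T (fun t => mu (phi t) + rho * sigma (phi t) * g t) by exact: L2D.
by apply: L2D.
Qed.

Lemma velocity_integrable g u : L2T g -> L2T u ->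
  leb.-integrable `[0, T] (EFin \o velocity g u).
Proof. by move=> Lg Lu; apply: L2_integrable; exact: velocity_L2. Qed.

Lemma near_controls_mid e p q : near_controls e p -> near_controls e q ->
  near_controls e (fun t => 2^-1 * p.1 t + 2^-1 * q.1 t,
                   fun t => 2^-1 * p.2 t + 2^-1 * q.2 t).
Proof.
move=> [Lp1 Lp2 pB pphi px] [Lq1 Lq2 qB qphi qx]; split => /=.
- exact: L2_linear.
- exact: L2_linear.
- have h1 : N2T (fun t => 2^-1 * p.1 t + 2^-1 * q.1 t) <= 2^-1 * N2T p.1 + 2^-1 * N2T q.1.
    exact: N2_half.
  have h2 : N2T (fun t => 2^-1 * p.2 t + 2^-1 * q.2 t) <= 2^-1 * N2T p.2 + 2^-1 * N2T q.2.
    exact: N2_half.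
  lra.
- move=> t tT; rewrite (volterra_linear T0 KV)//.
  move: (pphi t tT) (qphi t tT); rewrite !ler_norml => /andP[? ?] /andP[? ?].
  by apply/andP; split; lra.
- move=> t tT; have ip := integrable_subitv (velocity_integrable Lp1 Lp2) tT.
  have iq := integrable_subitv (velocity_integrable Lq1 Lq2) tT.
  have jp : leb.-integrable `[0, t] (EFin \o (fun s => 2^-1 * velocity p.1 p.2 s)).
    exact: integrableRZ.
  have jq : leb.-integrable `[0, t] (EFin \o (fun s => 2^-1 * velocity q.1 q.2 s)).
    exact: integrableRZ.
  have -> : \int[leb]_(s in `[0, t]) velocity (fun t => 2^-1 * p.1 t + 2^-1 * q.1 t)
      (fun t => 2^-1 * p.2 t + 2^-1 * q.2 t) s =
      2^-1 * \int[leb]_(s in `[0, t]) velocity p.1 p.2 s +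
      2^-1 * \int[leb]_(s in `[0, t]) velocity q.1 q.2 s.
    rewrite -!RintegralZl// -RintegralD//.
    by apply: eq_Rintegral => s _; rewrite /velocity; field.
  move: (px t tT) (qx t tT); rewrite !ler_norml => /andP[? ?] /andP[? ?].
  by apply/andP; split; lra.
Qed.

Lemma near_controls_le e d : e <= d -> near_controls e `<=` near_controls d.
Proof.
move=> ed p [h1 h2 h3 h4 h5]; split => // t tT.
  exact: le_trans (h4 t tT) ed.
exact: le_trans (h5 t tT) ed.
Qed.

(** The integrated velocity is continuous for the L2 distance, uniformly in [t], because [sigma] is
    bounded along [phi]. *)
Lemma velocity_dist_le g u e : 0 < e -> L2T g -> L2T u ->
  exists2 d, 0 < d & forall p, L2T p.1 -> L2T p.2 ->
    N2T (fun s => p.1 s - g s) < d -> N2T (fun s => p.2 s - u s) < d ->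
    forall t, t \in `[0, T] ->
      `|\int[leb]_(s in `[0, t]) velocity p.1 p.2 s
        - \int[leb]_(s in `[0, t]) velocity g u s| <= e.
Proof.
move=> e0 Lg Lu; have [C C0 CP] := bounded_ball (ltW M0) csigma.
have r0 := rho_bar_gt0 rho_gtN1 rho_lt1.
pose A : R := (`|rho| + rb) * C.
have A0 : 0 < A by rewrite mulr_gt0// ltr_wpDl.
(* Each squared distance is at most [th ^+ 2], so the total error is at most [A * th * (T + 2)],
   which is below [2 * A * th * (T + 1) = e]. *)
pose th : R := e / (2 * A * (T + 1)).
have den : 0 < 2 * A * (T + 1).
  by apply: mulr_gt0; [exact: mulr_gt0|exact: addr_gt0].
have th0 : 0 < th by rewrite divr_gt0.
exists (th ^+ 2); first by rewrite exprn_gt0.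
move=> p Lp1 Lp2 pg pu t tT.
have Ld1 : L2T (fun s => p.1 s - g s) by exact: L2B.
have Ld2 : L2T (fun s => p.2 s - u s) by exact: L2B.
have ip := velocity_integrable Lp1 Lp2; have ig := velocity_integrable Lg Lu.
have bound s : s \in `[0, T] -> `|velocity p.1 p.2 s - velocity g u s| <=
   A * th + A / th * (p.1 s - g s) ^+ 2 + A / th * (p.2 s - u s) ^+ 2.
  move=> sT; have -> : velocity p.1 p.2 s - velocity g u s =
     rho * sigma (phi s) * (p.1 s - g s) + rb * sigma (phi s) * (p.2 s - u s).
    by rewrite /velocity; ring.
  have amgm (z : R) : `|z| <= th / 2 + th^-1 * z ^+ 2.
    rewrite -(real_normK (num_real z)); set w := `|z|.
    have ti : 0 < th^-1 by rewrite invr_gt0.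
    have : 0 <= th^-1 * ((w - th / 2) ^+ 2 + th ^+ 2 / 4).
      by rewrite mulr_ge0 ?(ltW ti)// addr_ge0 ?sqr_ge0// divr_ge0 ?sqr_ge0.
    have -> : th^-1 * ((w - th / 2) ^+ 2 + th ^+ 2 / 4) = th / 2 + th^-1 * w ^+ 2 - w.
      by field; rewrite gt_eqF.
    by lra.
  have sC : `|sigma (phi s)| <= C by apply: CP; exact: phiM.
  have rA : `|rho| * C <= A by rewrite /A mulrDl lerDl mulr_ge0// ltW.
  have rA' : rb * C <= A by rewrite /A mulrDl lerDr mulr_ge0// ltW.
  apply: le_trans (ler_normD _ _) _.
  have -> : A * th + A / th * (p.1 s - g s) ^+ 2 + A / th * (p.2 s - u s) ^+ 2 =
    A * (th / 2 + th^-1 * (p.1 s - g s) ^+ 2) + A * (th / 2 + th^-1 * (p.2 s - u s) ^+ 2).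
    by field; rewrite gt_eqF.
  apply: lerD; rewrite normrM; apply: ler_pM => //.
    by rewrite normrM; apply: le_trans rA; rewrite ler_wpM2l.
  by rewrite normrM (gtr0_norm r0); apply: le_trans rA'; rewrite ler_pM2l.
apply: le_trans (Rintegral_itv_dist (ltW T0) ip ig Ld1 Ld2 bound tT) _.
have Ath : 0 < A / th by rewrite divr_gt0.
have h1 : A / th * N2T (fun s => p.1 s - g s) <= A / th * th ^+ 2 by rewrite ler_pM2l// ltW.
have h2 : A / th * N2T (fun s => p.2 s - u s) <= A / th * th ^+ 2 by rewrite ler_pM2l// ltW.
have h3 : A / th * th ^+ 2 = A * th by field; rewrite gt_eqF.
have h4 : th * (2 * A * (T + 1)) = e by rewrite /th divfK// gt_eqF.
rewrite h3 in h1 h2.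
have h5 : 0 < A * th by rewrite mulr_gt0.
have h6 : 0 < A * th * T by rewrite mulr_gt0.
by lra.
Qed.

(** Both approximate constraints are continuous for strong convergence in L2, so they become
    equalities in the limit, and the norm bound survives. *)
Lemma near_controls_limit :
  (forall n, near_controls n.+1%:R^-1 !=set0) ->
  exists g u, [/\ L2T g, L2T u, N2T g + N2T u <= B,
    forall t, t \in `[0, T] -> volterra T K g t = phi t &
    forall t, t \in `[0, T] -> x t = \int[leb]_(s in `[0, t]) velocity g u s].
Proof.
move=> ne; have := @decreasing_convex_limit _ _ _ leb `[0, T] _ (fun n => near_controls n.+1%:R^-1) B.
case=> //.
- move=> k n kn; apply: near_controls_le.
  by rewrite lef_pV2 ?posrE ?ltr0n// ler_nat.
- by move=> n p [].
- by move=> n p q; exact: near_controls_mid.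
move=> g [u [Lg Lu gu]]; exists g, u; split=> //.
(* Of [e * (B + 2)], the part [e * B] comes from the factor [1 + e] on the norm of [p], and the rest
   from two error terms of size at most [e]. *)
- have BB e : 0 < e -> N2T g + N2T u <= B + e * (B + 2).
    move=> e0; have e1 : 0 < e ^+ 2 / (1 + e) by rewrite divr_gt0 ?exprn_gt0//; lra.
    have [p [Lp1 Lp2 pB _ _] [pg pu]] := gu 0%N _ e1.
    have := N2_le_perturb e0 Lg Lp1; have := N2_le_perturb e0 Lu Lp2.
    have ei : 0 < 1 + e^-1 by rewrite addr_gt0// invr_gt0.
    have h : (1 + e^-1) * (e ^+ 2 / (1 + e)) = e by field; rewrite !gt_eqF//; lra.
    have h1 : (1 + e^-1) * N2T (fun s => p.1 s - g s) <= e by rewrite -[leRHS]h ler_pM2l// ltW.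
    have h2 : (1 + e^-1) * N2T (fun s => p.2 s - u s) <= e by rewrite -[leRHS]h ler_pM2l// ltW.
    have h3 : e * (N2T p.1 + N2T p.2) <= e * B by rewrite ler_pM2l.
    by lra.
  (* If [B] were below [-2], the case [e = 1] would make a sum of squared norms negative. *)
  have [B0|B0] := leP 0 (B + 2); last first.
    have := BB 1 ltr01; have := N2_ge0 leb `[0, T] g; have := N2_ge0 leb `[0, T] u; lra.
  apply/ler_addgt0Pr => e e0; have B3 : 0 < B + 3 by lra.
  apply: le_trans (BB (e / (B + 3)) _) _; first by rewrite divr_gt0.
  rewrite lerD2l mulrAC ler_pdivrMr// ler_pM2l//; lra.
- move=> t tT; apply/eqP; rewrite -subr_eq0 -normr_le0; apply/ler_addgt0Pr => e e0; rewrite add0r.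
  have [C C0 CP] := volterra_bound T0 KV.
  have e2 : 0 < e / 2 by rewrite divr_gt0.
  have /= [n _ /(_ n (leqnn n)) ne2] := near_infty_natSinv_lt (PosNum e2).
  (* The tolerance for which [volterra_bound] yields an error of at most [e / 2]. *)
  have d0 : 0 < (e / 2) ^+ 2 / C by rewrite divr_gt0// exprn_gt0.
  have [p [Lp1 Lp2 _ pphi _] [pg _]] := gu n _ d0.
  have Ld : L2T (fun s => p.1 s - g s) by exact: L2B.
  have := CP _ t tT Ld.
  have -> : volterra T K (fun s => p.1 s - g s) t = volterra T K p.1 t - volterra T K g t.
    have := volterra_linear T0 KV 1 (-1) tT Lp1 Lg; rewrite mul1r mulN1r => <-.
    by congr (volterra _ _ _ t); apply/funext => s; rewrite mul1r mulN1r.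
  move=> h; have h1 : `|volterra T K p.1 t - volterra T K g t| <= e / 2.
    rewrite -ler_sqr ?nnegrE ?(ltW e2)// real_normK ?num_real//; apply: (le_trans h).
    by rewrite mulrC -ler_pdivlMr// ltW.
  have h2 := pphi t tT.
  have := ler_normB (volterra T K p.1 t - phi t) (volterra T K p.1 t - volterra T K g t).
  have -> : volterra T K p.1 t - phi t - (volterra T K p.1 t - volterra T K g t) = volterra T K g t - phi t by ring.
  move=> /le_trans; apply; rewrite [leRHS]splitr lerD//.
  exact: ltW (le_lt_trans h2 ne2).
- move=> t tT; apply/eqP; rewrite -subr_eq0 -normr_le0; apply/ler_addgt0Pr => e e0; rewrite add0r.
  have e2 : 0 < e / 2 by rewrite divr_gt0.
  have /= [n _ /(_ n (leqnn n)) ne2] := near_infty_natSinv_lt (PosNum e2).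
  have [d d0 dP] := velocity_dist_le e2 Lg Lu.
  have [p [Lp1 Lp2 _ _ px] [pg pu]] := gu n _ d0.
  have h1 := dP p Lp1 Lp2 pg pu t tT; have h2 := px t tT.
  apply: le_trans (ler_distD (\int[leb]_(s in `[0, t]) velocity p.1 p.2 s) _ _) _.
  rewrite [leRHS]splitr; apply: lerD => //.
  exact: ltW (le_lt_trans h2 ne2).
Qed.

(** The primitive [f] of [g] has [hat K f = phi] on [[0, T]], and then the residual of [x] and [f]
    equals [u] almost everywhere. *)
Lemma rate_le_of_control g u : L2T g -> L2T u ->
  (forall t, t \in `[0, T] -> volterra T K g t = phi t) ->
  (forall t, t \in `[0, T] -> x t = \int[leb]_(s in `[0, t]) velocity g u s) ->
  H01 T x /\ exists2 f, H01 T f &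
    cost T K mu sigma rho id x f = (2^-1 * (N2T g + N2T u))%:E.
Proof.
move=> Lg Lu gphi xv; pose f t := \int[leb]_(s in `[0, t]) g s.
have [Hf aef] := H01_of_primitive T0 Lg (fun t _ => erefl (f t)).
have [Hx aex] := H01_of_primitive T0 (velocity_L2 Lg Lu) xv.
split=> //; exists f => //.
have Lf := H01_L2 Hf; have Lx := H01_L2 Hx.
have [mf _] := Lf; have [mg _] := Lg; have [mu' _] := Lu.
have hatf t : t \in `[0, T] -> hat K f t = phi t.
  move=> tT; rewrite (hat_volterra KC)// -gphi// /volterra /Rintegral; congr fine.
  have [C C0 KL] := kernel_L2 T0 KV; have [[mK _] _] := KL t tT.
  apply: ae_eq_integral => //.
  - by apply/measurable_EFinP; exact: measurable_funM.
  - by apply/measurable_EFinP; exact: measurable_funM.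
  - apply: (@filterS _ _ (ae_filter_ringOfSetsType leb) _ _ _ aef) => s fs sT.
    by rewrite fs// inE.
have Lr : L2T (residual K mu sigma rho id x f) by exact: residual_L2.
have [mr _] := Lr.
rewrite costE//; congr (_%:E); rewrite mulrDr; congr (_ + _).
  by congr (_ * _); exact: ae_eq_N2.
congr (_ * _); apply: ae_eq_N2 => //.
have aefx := @filterI _ _ (ae_filter_ringOfSetsType leb) _ _ aef aex.
apply: (@filterS _ _ (ae_filter_ringOfSetsType leb) _ _ _ aefx) => t [ft xt] tT.
have tT' : t \in `[0, T] by move: tT; rewrite inE.
rewrite /residual (hatf t tT') (ft tT) (xt tT) /velocity.
have r0 := rho_bar_gt0 rho_gtN1 rho_lt1; have s0 := sigma_gt0 (phi t).
by field; rewrite !gt_eqF.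
Qed.

(** Half of the tolerance pays for replacing [y] by [x], the other half for replacing [hat K f] by
    [phi] in the velocity, both on the grid and off it. *)
Lemma near_controls_of_path e eta n y f : (0 < n)%N -> H01 T y -> H01 T f ->
  N2T (derive1 f) + N2T (residual K mu sigma rho (grid T n) y f) <= B ->
  (forall t, t \in `[0, T] ->
    [/\ `|hat K f t - phi t| <= e, `|y t - x t| <= e / 2,
      `|mu (hat K f t) - mu (phi t)| <= eta,
      `|sigma (hat K f (grid T n t)) - sigma (phi t)| <= eta &
      `|sigma (hat K f t) - sigma (phi t)| <= eta]) ->
  eta * (3 * T + B) <= e / 2 ->
  near_controls e (derive1 f, residual K mu sigma rho (grid T n) y f).
Proof.
move=> n0 Hy Hf NB close etaB; have Lf := H01_L2 Hf; have Ly := H01_L2 Hy.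
have gT t : t \in `[0, T] -> grid T n t \in `[0, T] by exact: grid_itv.
have mg := measurable_grid n T0.
have Lr : L2T (residual K mu sigma rho (grid T n) y f) by exact: residual_L2.
split=> //= t tT.
  by rewrite -(hat_volterra KC)//; case: (close t tT).
have r0 := rho_bar_gt0 rho_gtN1 rho_lt1.
have r1 : rb <= 1.
  by rewrite /rho_bar -[leRHS]sqrtr1 ler_wsqrtr// lerBlDr lerDl sqr_ge0.
have rho1 : `|rho| <= 1 by rewrite ler_norml !ltW.
have iy := L2_integrable Ly; have iv := velocity_integrable Lf Lr.
have eta0 : 0 <= eta by have [_ _ h _ _] := close t tT; apply: le_trans h.
(* One [eta] comes from [mu], and each [sigma] term contributes [eta * (1 + z ^+ 2)] through
   [|z| <= 1 + z ^+ 2]; integration gives [eta * (3 * T + B)]. *)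
have bound s : s \in `[0, T] -> `|derive1 y s - velocity (derive1 f)
    (residual K mu sigma rho (grid T n) y f) s| <=
    3 * eta + eta * derive1 f s ^+ 2 + eta * residual K mu sigma rho (grid T n) y f s ^+ 2.
  move=> sT; have [_ _ c1 c2 c3] := close s sT.
  rewrite (residualK K mu rho_gtN1 rho_lt1 sigma_gt0 (grid T n) y f s) /velocity.
  set u := residual _ _ _ _ _ _ _ _; set g := derive1 f s.
  have -> : mu (hat K f s) + rho * sigma (hat K f (grid T n s)) * g + rb * sigma (hat K f s) * u -
     (mu (phi s) + rho * sigma (phi s) * g + rb * sigma (phi s) * u) =
     (mu (hat K f s) - mu (phi s)) + rho * ((sigma (hat K f (grid T n s)) - sigma (phi s)) * g)
     + rb * ((sigma (hat K f s) - sigma (phi s)) * u) by ring.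
  have le1 (z : R) : `|z| <= 1 + z ^+ 2.
    rewrite -(real_normK (num_real z)); set w := `|z|.
    by have := sqr_ge0 (w - 2^-1); lra.
  have prod (a b z : R) : `|a| <= 1 -> `|b| <= eta -> `|a * (b * z)| <= eta * (1 + z ^+ 2).
    move=> a1 b1; rewrite !normrM -[leRHS]mul1r.
    by apply: ler_pM => //; apply: ler_pM.
  have p1 := prod _ _ g rho1 c2.
  have rb1 : `|rb| <= 1 by rewrite gtr0_norm.
  have p2 := prod _ _ u rb1 c3.
  apply: le_trans (ler_normD _ _) _.
  have -> : 3 * eta + eta * g ^+ 2 + eta * u ^+ 2 =
    (eta + eta * (1 + g ^+ 2)) + eta * (1 + u ^+ 2) by ring.
  by apply: lerD p2; apply: le_trans (ler_normD _ _) _; exact: lerD.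
have := Rintegral_itv_dist (ltW T0) iy iv Lf Lr bound tT.
rewrite -(H01_primitive Hy tT) => h.
have [_ hy _ _ _] := close t tT; rewrite distrC in hy.
set V := \int[_]_(_ in _) _ in h *.
have := ler_normD (x t - y t) (y t - V); rewrite addrA subrK => /le_trans; apply.
rewrite [leRHS]splitr; apply: lerD => //; apply: (le_trans h); apply: le_trans etaB.
have := ler_wpM2l eta0 NB; lra.
Qed.

End controls.

(** * Passage to the limit along paths of bounded cost *)

Section lower_bound.
Variables (R : realType) (T : R) (K : R -> R -> R) (mu sigma : R -> R) (rho : R).
Local Notation leb := (@lebesgue_measure R).
Hypothesis T0 : 0 < T.
Hypotheses (KV : volterra_kernel T K) (KC : kernel_causal T K)
  (KH : kernel_holder T K).
Hypotheses (rho_gtN1 : -1 < rho) (rho_lt1 : rho < 1).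
Hypotheses (cmu : continuous mu) (csigma : continuous sigma)
  (sigma_gt0 : forall x, 0 < sigma x).
Implicit Types (x f y : R -> R) (c e t : R).
Local Notation N2T := (N2 leb `[0, T]).

Lemma cost_limit x c :
  (forall n, exists m y f, [/\ (n < m)%N, H01 T y, H01 T f,
     forall t, t \in `[0, T] -> `|y t - x t| <= n.+1%:R^-1 &
     (cost T K mu sigma rho (grid T m) y f < c%:E)%E]) ->
  H01 T x /\ exists2 f, H01 T f & (cost T K mu sigma rho id x f <= c%:E)%E.
Proof.
move=> seq.
have pick n : exists p : nat * ((R -> R) * (R -> R)), [/\ (n < p.1)%N,
    H01 T p.2.1, H01 T p.2.2,
    forall t, t \in `[0, T] -> `|p.2.1 t - x t| <= n.+1%:R^-1 &
    N2T (derive1 p.2.2) +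
    N2T (residual K mu sigma rho (grid T p.1) p.2.1 p.2.2) <= 2 * c].
  have [m [y [f [nm Hy Hf yx]]]] := seq n.
  have m0 : (0 < m)%N by exact: leq_trans nm.
  rewrite costE//; last 2 first.
  - exact: measurable_grid.
  - by move=> t; exact: grid_itv.
  (* The factor 2 in [2 * c] undoes the factor one half of both cost terms. *)
  rewrite lte_fin => /ltW Nc; exists (m, (y, f)); split=> //=.
  by move: Nc; set a := N2 _ _ _; set b := N2 _ _ _; lra.
have [p pP] := choice pick => {seq pick}.
pose m k := (p k).1; pose y k := (p k).2.1; pose f k := (p k).2.2.
have Hf k : H01 T (f k) by case: (pP k).
have NB k : N2T (derive1 (f k)) +
    N2T (residual K mu sigma rho (grid T (m k)) (y k) (f k)) <= 2 * c by case: (pP k).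
have Nf k : N2T (derive1 (f k)) <= 2 * c.
  by apply: le_trans (NB k); rewrite lerDl N2_ge0.
have B0 : 0 <= 2 * c by apply: le_trans (Nf 0%N); exact: N2_ge0.
have [M M0 MP] := hat_bounded T0 KV KC (2 * c).
have fM k t : t \in `[0, T] -> `|hat K (f k) t| <= M by move=> tT; exact: MP.
have feq e : 0 < e -> exists2 d : R, 0 < d & forall k s t, s \in `[0, T] ->
     t \in `[0, T] -> `|s - t| < d -> `|hat K (f k) s - hat K (f k) t| <= e.
  move=> e0; have [d d0 dP] := volterra_equicontinuous T0 KV KH B0 e0.
  exists d => // k s t sT tT st; rewrite !(hat_volterra KC)//; apply: dP => //.
  exact: H01_L2.
(* As [F] refines [\oo], everything that holds eventually in [k] can be combined with uniform
   closeness to [phi]. *)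
have [F [FU Foo]] := @ultraFilterLemma nat \oo _.
have [phi [uphi phiM Fphi]] := ultra_uniform_limit T0 FU fM feq.
have FP : ProperFilter F by exact: ultra_proper.
have [|g [u [Lg Lu gu gphi xv]]] := @near_controls_limit R T K mu sigma rho T0 KV
    rho_gtN1 rho_lt1 cmu csigma x phi M (2 * c) M0 uphi phiM; last first.
  have [Hx [h Hh hc]] := rate_le_of_control T0 KV KC KH rho_gtN1 rho_lt1 cmu csigma
    sigma_gt0 M0 uphi phiM Lg Lu gphi xv.
  split=> //; exists h => //; rewrite hc lee_fin.
  by move: gu; set a := N2 _ _ _; set b := N2 _ _ _; lra.
(* It remains to find, for each tolerance, a term of the sequence whose own pair of controls is
   nearly admissible. *)
move=> n; set e : R := n.+1%:R^-1; have e0 : 0 < e by rewrite invr_gt0.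
have den : 0 < 3 * T + 2 * c + 1 by rewrite ltr_wpDl// addr_ge0// mulr_ge0// ltW.
(* Small enough for the condition [eta * (3 * T + 2 * c) <= e / 2] of [near_controls_of_path]. *)
pose eta : R := e / 2 / (3 * T + 2 * c + 1).
have eta0 : 0 < eta by rewrite !divr_gt0.
have [d1 d10 d1P] := heine_ball (ltW M0) cmu eta0.
have [d2 d20 d2P] := heine_ball (ltW M0) csigma eta0.
pose d : R := Num.min e (Num.min d1 d2).
have d0 : 0 < d by rewrite !lt_min e0 d10.
(* One quarter for the distance of [hat K (f k)] to [phi] and one for the oscillation of [phi] over
   a grid cell: together they stay below [d]. *)
have d4 : 0 < d / 4 by rewrite divr_gt0.
have [r r0 rP] := uphi _ d4.
have [N NP] := grid_close T0 r0.
have e2 : 0 < e / 2 by rewrite divr_gt0.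
have /= [N' _ N'P] := near_infty_natSinv_lt (PosNum e2).
have Fn : F [set k | (maxn N N' <= k)%N] by apply: Foo; exists (maxn N N').
have [k [/= kphi]] := filter_ex (filterI (Fphi _ d4) Fn).
rewrite geq_max => /andP[kN kN'].
have [km Hy _ yx _] := pP k.
have m0 : (0 < m k)%N by exact: leq_trans km.
exists (derive1 (f k), residual K mu sigma rho (grid T (m k)) (y k) (f k)).
have etaB : eta * (3 * T + 2 * c) <= e / 2.
  have : eta * (3 * T + 2 * c + 1) = e / 2 by rewrite /eta divfK// gt_eqF.
  by move=> <-; rewrite ler_pM2l// lerDl.
suff close t : t \in `[0, T] ->
    [/\ `|hat K (f k) t - phi t| <= e, `|y k t - x t| <= e / 2,
      `|mu (hat K (f k) t) - mu (phi t)| <= eta,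
      `|sigma (hat K (f k) (grid T (m k) t)) - sigma (phi t)| <= eta &
      `|sigma (hat K (f k) t) - sigma (phi t)| <= eta].
  exact: (near_controls_of_path T0 KV KC KH rho_gtN1 rho_lt1
    cmu csigma sigma_gt0 M0 uphi phiM m0 Hy (Hf k) (NB k) close etaB).
move=> tT.
have gT : grid T (m k) t \in `[0, T] by exact: grid_itv.
have [_ tg] := NP (m k) t (leq_trans kN (ltnW km)) tT.
have c1 : `|hat K (f k) t - phi t| < d by apply: le_lt_trans (kphi t tT) _; lra.
have c2 : `|hat K (f k) (grid T (m k) t) - phi t| < d.
  have := ler_normB (hat K (f k) (grid T (m k) t) - phi (grid T (m k) t)) (phi t - phi (grid T (m k) t)).
  rewrite opprB addrA subrK => /le_lt_trans; apply.
  have := rP _ _ tT gT tg; have := kphi _ gT; lra.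
have dd1 : d <= d1 by rewrite !ge_min lexx orbT.
have dd2 : d <= d2 by rewrite !ge_min lexx !orbT.
have de : d <= e by rewrite ge_min lexx.
split.
- exact: ltW (lt_le_trans c1 de).
- apply: le_trans (yx t tT) _; apply: ltW; exact: N'P.
- by apply: ltW; apply: d1P; rewrite ?fM ?phiM//; exact: lt_le_trans dd1.
- by apply: ltW; apply: d2P; rewrite ?fM ?phiM//; exact: lt_le_trans dd2.
- by apply: ltW; apply: d2P; rewrite ?fM ?phiM//; exact: lt_le_trans dd2.
Qed.

End lower_bound.

(** * Identification of the rate function *)

(** [sup] dominates the values only when they are bounded above, which the extreme value theorem
    provides for elements of [C0 T]. *)
Lemma sup_norm_ge (R : realType) (T : R) (x y : C0 T) t : 0 < T -> t \in `[0, T] ->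
  `|C0_fun y t - C0_fun x t| <= sup_norm T (C0_fun y \- C0_fun x).
Proof.
move=> T0 tT; apply: sup_ubound; last by exists t.
have [cx _ _] := set_valP x; have [cy _ _] := set_valP y.
have cn : {within `[0, T], continuous (fun t => `|C0_fun y t - C0_fun x t|)}.
  by move=> s; apply: cvg_norm; apply: cvgB; [exact: cy|exact: cx].
have [c _ cP] := EVT_max (ltW T0) cn.
by exists `|C0_fun y c - C0_fun x c| => _ [s sT <-]; exact: cP.
Qed.

Lemma sup_norm_self_lt (R : realType) (T : R) (x : C0 T) (delta : R) : 0 < T -> 0 < delta ->
  sup_norm T (C0_fun x \- C0_fun x) < delta.
Proof.
move=> T0 d0; apply: le_lt_trans d0; apply: ge_sup.
  by exists `|(C0_fun x \- C0_fun x) 0|, 0 => //=; rewrite in_itv/= lexx ltW.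
by move=> _ [t _ <-]; rewrite /= subrr normr0.
Qed.

Section rate_identification.
Variables (R : realType) (T : R) (K : R -> R -> R) (mu sigma : R -> R) (rho : R).
Hypothesis T0 : 0 < T.
Hypotheses (KV : volterra_kernel T K) (KC : kernel_causal T K)
  (KH : kernel_holder T K).
Hypotheses (rho_gtN1 : -1 < rho) (rho_lt1 : rho < 1).
Hypotheses (cmu : continuous mu) (csigma : continuous sigma)
  (sigma_gt0 : forall x, 0 < sigma x).

(** The path [x] itself competes in every local infimum, so it suffices to refine the grid for one
    fixed [f] at a time. *)
Lemma limn_einf_local_inf_le (x : C0 T) (delta : R) : 0 < delta ->
  (limn_einf (fun m => local_inf K mu sigma rho m x delta) <= rate_Z K mu sigma rho x)%E.
Proof.
move=> d0; rewrite /rate_Z /rate; case: ifPn => [/set_mem Hx|_]; last exact: leey.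
apply: le_ereal_inf_tmp => _ [f Hf <-]; apply/lee_addgt0Pr => e e0.
have [N NP] := cost_grid_le T0 KV KC KH rho_gtN1 rho_lt1 cmu csigma sigma_gt0 Hx Hf e0.
apply: limn_einf_le; exists N => n /NP; apply: le_trans.
apply: (@le_trans _ _ (rate_m K mu sigma rho n x)).
  by apply: ereal_inf_lbound; exists x => //=; exact: sup_norm_self_lt.
by rewrite /rate_m /rate mem_set//; apply: ereal_inf_lbound; exists f.
Qed.

(** A diagonal choice: first a radius below [n.+1%:R^-1], then a grid index above [n], then [y] and
    [f] from the two infima. A finite rate forces [y] into [H01]. *)
Lemma rate_Z_le (x : C0 T) (c : R) :
  (\forall delta \near 0^'+,
    (limn_einf (fun m => local_inf K mu sigma rho m x delta) < c%:E)%E) ->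
  (rate_Z K mu sigma rho x <= c%:E)%E.
Proof.
move=> nearc.
have [|Hx [f Hf fc]] := @cost_limit R T K mu sigma rho T0 KV KC KH rho_gtN1 rho_lt1
    cmu csigma sigma_gt0 (C0_fun x) c; last first.
  rewrite /rate_Z /rate mem_set//; apply: le_trans fc.
  by apply: ereal_inf_lbound; exists f.
move=> n; have n0 : 0 < n.+1%:R^-1 :> R by rewrite invr_gt0.
have [d [/= dn dlt]] := filter_ex (filterI (nbhs_right_lt n0) nearc).
have [m nm] := limn_einf_lt dlt n.+1.
move=> /ereal_inf_lt[_ [y /= yx <-]]; rewrite /rate_m /rate.
case: ifPn => [/set_mem Hy|]; last by rewrite ltNge leey.
move=> /ereal_inf_lt[_ [f Hf <-] fc]; exists m, (C0_fun y), f; split=> // t tT.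
apply: le_trans (sup_norm_ge x y T0 tT) _.
exact: ltW (lt_trans yx dn).
Qed.

End rate_identification.

Theorem theorem6p31 (R : realType) (T : R) (T_gt0 : 0 < T)
  (d : measure_display) (Omega : measurableType d) (P : probability Omega R)
  (W B : R -> {RV P >-> R})
  (W_brownian : brownian_motion W) (B_brownian : brownian_motion B)
  (W_B_independent : independent_processes W B)
  (K : R -> R -> R) (K_volterra : volterra_kernel T K)
  (K_causal : kernel_causal T K) (K_holder : kernel_holder T K)
  (Bhat : R -> {RV P >-> R})
  (Bhat_volterra : volterra_process T K (joint_filtration W B) B Bhat)
  (Bhat_nondegenerate : nondegenerate_process T Bhat)
  (rho : R) (rho_gtN1 : -1 < rho) (rho_lt1 : rho < 1) (x0 : R)
  (eps : nat -> R) (eps_gt0 : forall n, 0 < eps n)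
  (eps_cvg0 : eps n @[n --> \oo] --> 0)
  (mu sigma : R -> R)
  (mu_continuous : continuous mu) (sigma_continuous : continuous sigma)
  (sigma_gt0 : forall x, 0 < sigma x)
  (omega : R -> R) (omega_modulus : modulus_of_continuity omega)
  (sigma_omega : locally_continuous omega sigma)
  (alpha M1 M2 : R) (alpha_gt0 : 0 < alpha) (M1_gt0 : 0 < M1) (M2_gt0 : 0 < M2)
  (growth : forall x, sigma x + `|mu x| <= M1 + M2 * `|x| `^ alpha)
  (Z : nat -> R -> {RV P >-> R})
  (Z_log_price : forall n,
    log_price T mu sigma rho x0 (eps n) (joint_filtration W B) W B Bhat (Z n))
  (X : nat -> Omega -> C0 T)
  (X_centered : forall n w (t : R), t \in `[0, T] -> C0_fun (X n w) t = Z n t w - x0)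
  (I_Z : C0 T -> \bar R)
  (I_Z_good : good_rate_function I_Z)
  (I_Z_LDP : LDP (fun n A => P (X n @^-1` A)) (fun n => (eps n) ^- 2) I_Z)
  (I_Z_liminf : forall x : C0 T,
    limn_einf (fun m => local_inf K mu sigma rho m x delta) @[delta --> 0^'+]
      --> I_Z x)
  (I_Z_limsup : forall x : C0 T,
    limn_esup (fun m => local_inf K mu sigma rho m x delta) @[delta --> 0^'+]
      --> I_Z x) :
  forall x : C0 T, I_Z x = rate_Z K mu sigma rho x.
Proof.
move=> x; apply/eqP; rewrite eq_le; apply/andP; split.
  (* The bound holds at every positive radius and passes to the limit in [delta]. *)
  apply: cvge_to_le (I_Z_liminf x) _.
  apply: filterS (nbhs_right_gt 0) => delta.
  exact: limn_einf_local_inf_le.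
apply/lee_addgt0Pr => e e0.
have [Iy|] := eqVneq (I_Z x) +oo%E; first by rewrite Iy addye// leey.
rewrite -ltey => Iy.
have I0 : (0 <= I_Z x)%E by case: I_Z_good => -[].
have Ifin : I_Z x \is a fin_num by rewrite ge0_fin_numE.
rewrite -(fineK Ifin) -EFinD; apply: rate_Z_le => //.
(* The finite value [I_Z x] is strictly below [I_Z x + e], hence so are the inferior limits at all
   small radii. *)
have nb : nbhs (I_Z x) [set y | (y < (fine (I_Z x) + e)%:E)%E].
  apply: open_nbhs_nbhs; split; first exact: open_ereal_lt_ereal.
  by rewrite /= -{1}(fineK Ifin) lte_fin ltrDl.
exact: I_Z_liminf nb.
Qed.
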